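(* Let $d\ge7$ be prime, $n\ge1$, $\alpha\in[1/2,+\infty]$, and $\Lambda$ an $n$-qudit quantum channel. Then $H_\alpha(\mathcal M(\Lambda))\ge H_\alpha(\Lambda)$.
   Context: Fix a prime $d$; $\chi(k)=e^{2\pi ik/d}$, $X|k\rangle=|k+1\rangle$, $Z|k\rangle=\chi(k)|k\rangle$ on $\mathbb C^d$; Weyl operators $w(p,q)=\chi(-2^{-1}pq)Z^pX^q$ (odd $d$), $w(\vec p,\vec q)=\bigotimes_kw(p_k,q_k)$; characteristic function $\Xi_\rho(\vec x)=\mathrm{Tr}[\rho\,w(-\vec x)]$ for states on any number of qudits. The mean state $\mathcal M(\rho)$ has $\Xi_{\mathcal M(\rho)}(\vec x)=\Xi_\rho(\vec x)$ if $|\Xi_\rho(\vec x)|=1$ and $0$ otherwise. The Choi state of an $n$-qudit channel $\Lambda$ is $J_\Lambda=(\mathrm{id}_A\otimes\Lambda)(|\Phi\rangle\langle\Phi|)$, $|\Phi\rangle=d^{-n/2}\sum_{\vec j}|\vec j\rangle_A|\vec j\rangle_{A'}$. The mean channel $\mathcal M(\Lambda)$ is the channel with Choi state $\mathcal M(J_\Lambda)$ (which is again a valid Choi state). Let $\mathcal R(\rho)=\mathrm{Tr}[\rho]I_n/d^n$. With $D_\alpha$ the sandwiched Rényi relative entropy $D_\alpha(\rho\|\sigma)=\frac1{\alpha-1}\log\mathrm{Tr}[(\sigma^{\frac{1-\alpha}{2\alpha}}\rho\sigma^{\frac{1-\alpha}{2\alpha}})^\alpha]$, define $D_\alpha(\Lambda\|\mathcal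 R)=\sup_{\rho_{AR}}D_\alpha((\Lambda\otimes\mathrm{id}_R)(\rho_{AR})\|(\mathcal R\otimes\mathrm{id}_R)(\rho_{AR}))$ over all ancillas $R$ and states $\rho_{AR}$, and the channel Rényi entropy $H_\alpha(\Lambda)=n\log d-D_\alpha(\Lambda\|\mathcal R)$. *)

(* Defs.v *)
From HB Require Import structures.
From mathcomp Require Import all_boot all_order all_algebra.
From mathcomp Require Import all_classical all_reals all_analysis.
From mathcomp Require Import complex mxtens.

Set Implicit Arguments.
Unset Strict Implicit.
Unset Printing Implicit Defensive.

Import Order.TTheory GRing.Theory Num.Theory.
Local Open Scope ring_scope.

Section QuantumDefs.
Variable R : realType.
Local Notation C := (R[i]).

Definition adj (m n : nat) (A : 'M[C]_(m, n)) : 'M[C]_(n, m) := map_mx Num.conj A^T.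

Definition psd (m : nat) (A : 'M[C]_m) : Prop :=
  forall v : 'cV[C]_m, 0 <= (adj v *m A *m v) 0 0.

Definition is_state (m : nat) (rho : 'M[C]_m) : Prop := psd rho /\ \tr rho = 1.

Definition unitary (m : nat) (U : 'M[C]_m) : Prop := U *m adj U = 1%:M.

Definition realC (x : R) : C := Complex x 0.

Definition spec_decomp (m : nat) (A : 'M[C]_m) (U : 'M[C]_m) (l : 'rV[R]_m) : Prop :=
  unitary U /\ A = U *m diag_mx (map_mx realC l) *m adj U.

(* functional calculus f(A) = U diag(f(l)) U^* for a Hermitian matrix A
   (well defined, independent of the chosen decomposition) *)
Definition mfun (f : R -> R) (m : nat) (A : 'M[C]_m) : 'M[C]_m :=
  match pselect (exists UL : 'M[C]_m * 'rV[R]_m, spec_decomp A UL.1 UL.2) with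
  | left H => let UL := projT1 (cid H) in
              UL.1 *m diag_mx (map_mx (fun x => realC (f x)) UL.2) *m adj UL.1
  | right _ => 0
  end.

(* power / logarithm taken on the support (generalized inverse convention) *)
Definition pospow (p : R) (x : R) : R := if 0 < x then powR x p else 0.
Definition poslog (x : R) : R := if 0 < x then ln x else 0.

Definition supp_incl (m : nat) (rho sigma : 'M[C]_m) : Prop :=
  forall v : 'rV[C]_m, v *m sigma = 0 -> v *m rho = 0.

Definition sandQ (a : R) (m : nat) (rho sigma : 'M[C]_m) : R :=
  let S := mfun (pospow ((1 - a) / (2 * a))) sigma in
  complex.Re (\tr (mfun (pospow a) (S *m rho *m S))).

Definition D_fin (a : R) (m : nat) (rho sigma : 'M[C]_m) : \bar R :=
  let Q := sandQ a rho sigma in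
  if a < 1 then (if Q == 0 then +oo%E else ((a - 1)^-1 * ln Q)%:E)
  else if `[< supp_incl rho sigma >] then ((a - 1)^-1 * ln Q)%:E else +oo%E.

Definition D_one (m : nat) (rho sigma : 'M[C]_m) : \bar R :=
  if `[< supp_incl rho sigma >]
  then (complex.Re (\tr (rho *m (mfun poslog rho - mfun poslog sigma))))%:E
  else +oo%E.

Definition D_max (m : nat) (rho sigma : 'M[C]_m) : \bar R :=
  ereal_inf [set (ln l)%:E | l in [set l : R | 0 < l /\ psd (realC l *: sigma - rho)]].

Definition D_alpha (alpha : \bar R) (m : nat) (rho sigma : 'M[C]_m) : \bar R :=
  match alpha with
  | EFin a => if a == 1 then D_one rho sigma else D_fin a rho sigma
  | EPInf => D_max rho sigma
  | ENInf => 0%E (* not used: alpha >= 1/2 *)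
  end.

(* (L (x) id_R) acting on 'M_(N*m), system index first, ancilla second *)
Definition tens_id (N : nat) (L : 'M[C]_N -> 'M[C]_N) (m : nat) (X : 'M[C]_(N * m))
  : 'M[C]_(N * m) :=
  \matrix_(r, c)
    let ia := mxtens_unindex r in let jb := mxtens_unindex c in
    L (\matrix_(i', j') X (mxtens_index (i', ia.2)) (mxtens_index (j', jb.2))) ia.1 jb.1.

Definition is_channel (N : nat) (L : 'M[C]_N -> 'M[C]_N) : Prop :=
  [/\ forall (c : C) (X Y : 'M[C]_N), L (c *: X + Y) = c *: L X + L Y,
      forall X : 'M[C]_N, \tr (L X) = \tr X
    & forall (m : nat) (rho : 'M[C]_(N * m)), psd rho -> psd (tens_id L rho)].

Definition replacer (N : nat) (X : 'M[C]_N) : 'M[C]_N := (\tr X / N%:R) *: 1%:M.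

Definition D_chan (alpha : \bar R) (N : nat) (L : 'M[C]_N -> 'M[C]_N) : \bar R :=
  ereal_sup [set D | exists (m : nat) (rho : 'M[C]_(N * m)),
     is_state rho /\ D = D_alpha alpha (tens_id L rho) (tens_id (@replacer N) rho)].

Definition H_chan (alpha : \bar R) (d n : nat) (L : 'M[C]_(d ^ n) -> 'M[C]_(d ^ n)) : \bar R :=
  ((n%:R * ln d%:R)%:E - D_chan alpha L)%E.

Definition chi (d : nat) (z : int) : C :=
  Complex (cos (2 * pi * z%:~R / d%:R)) (sin (2 * pi * z%:~R / d%:R)).

(* j-th qudit of the computational basis index k of n qudits *)
Definition digit (d j k : nat) : nat := (k %/ d ^ j) %% d.

(* w(p,q) = (x)_j chi(-2^{-1} p_j q_j) Z^{p_j} X^{q_j};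
   <k'| w(p,q) |k> = [k' = k + q] prod_j chi(-2^{-1} p_j q_j + p_j k'_j);
   2^{-1} mod d (d odd) is represented by (d+1)/2 *)
Definition weyl (d n : nat) (p q : 'I_n -> int) : 'M[C]_(d ^ n) :=
  \matrix_(k', k)
    if [forall j : 'I_n,
          (((digit d j k')%:Z - (digit d j k)%:Z - q j) %% d%:Z)%Z == 0]
    then \prod_(j < n) chi d (- ((d.+1)./2%:Z * p j * q j) + p j * (digit d j k')%:Z)
    else 0.

Definition charfun (d n : nat) (rho : 'M[C]_(d ^ n)) (p q : 'I_n -> int) : C :=
  \tr (rho *m @weyl d n (fun j => - p j) (fun j => - q j)).

Definition toZ (d n : nat) (p : {ffun 'I_n -> 'I_d}) : 'I_n -> int :=
  fun j => (nat_of_ord (p j))%:Z.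

(* mean state: the operator whose characteristic function is Xi_rho on
   {x : |Xi_rho(x)| = 1} and 0 elsewhere, via the Weyl expansion
   sigma = d^{-n} sum_x Xi_sigma(x) w(x) *)
Definition mean_state (d n : nat) (rho : 'M[C]_(d ^ n)) : 'M[C]_(d ^ n) :=
  (d%:R ^- n) *:
  \sum_(p : {ffun 'I_n -> 'I_d}) \sum_(q : {ffun 'I_n -> 'I_d})
     (let c := @charfun d n rho (toZ p) (toZ q) in
      if `|c| == 1 then c *: @weyl d n (toZ p) (toZ q) else 0).

(* Choi state J = (id_A (x) L)(|Phi><Phi|), A first *)
Definition choi (N : nat) (L : 'M[C]_N -> 'M[C]_N) : 'M[C]_(N * N) :=
  \matrix_(r, c)
    let ik := mxtens_unindex r in let jl := mxtens_unindex c in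
    N%:R^-1 * L (delta_mx ik.1 jl.1) ik.2 jl.2.

Definition mean_choi (d n : nat) (L : 'M[C]_(d ^ n) -> 'M[C]_(d ^ n))
  : 'M[C]_(d ^ n * d ^ n) :=
  castmx (expnD d n n, expnD d n n)
    (@mean_state d (n + n) (castmx (esym (expnD d n n), esym (expnD d n n)) (choi L))).

(* mean channel: the (unique linear) map whose Choi state is M(J_L) *)
Definition mean_channel (d n : nat) (L : 'M[C]_(d ^ n) -> 'M[C]_(d ^ n))
  : 'M[C]_(d ^ n) -> 'M[C]_(d ^ n) :=
  fun X => \matrix_(k, l)
    ((d ^ n)%:R * \sum_(i < d ^ n) \sum_(j < d ^ n)
        X i j * mean_choi L (mxtens_index (i, k)) (mxtens_index (j, l))).

End QuantumDefs.

Arguments H_chan {R} alpha d n L.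
Arguments mean_channel {R} d n L _.
Arguments is_channel {R} N L.

(* Main.v *)
Require Import Defs.
From HB Require Import structures.
From mathcomp Require Import all_boot all_order all_algebra.
From mathcomp Require Import all_classical all_reals all_analysis.
From mathcomp Require Import complex mxtens.
From mathcomp Require Import spectral sesquilinear.
From mathcomp Require Import ring lra.

Set Implicit Arguments.
Unset Strict Implicit.
Unset Printing Implicit Defensive.

Import Order.TTheory GRing.Theory Num.Theory.
Local Open Scope ring_scope.

(* Let G be the set of phase points x with |Xi_J(x)| = 1, where J is the Choi
   state of L. If |Tr(rho w)| = 1 for a unitary w then rho w = Tr(rho w) rho, so
   G is a group, and the Fourier transform mu of its indicator is nonnegative;
   conjugation by w(y) multiplies w(x) by a character, hence the mean state is
   the mixture sum_y mu(y) w(y) J w(y)^*. At the level of channels,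
   M(L)(X) = sum_y mu(y) B_y L(A_y X A_y^* ) B_y^* with A_y, B_y unitary.
   Applying this to a state rho, every term has the same second argument
   I/N (x) rho_R in the relative entropy, which is invariant under the unitaries
   B_y (x) 1. So only quasi-convexity of rho -> D_alpha(rho || sigma) at fixed
   sigma is needed, which reduces to convexity of trace functions rather than to
   data processing. *)

(** * Spectral decompositions and functional calculus *)

(** The rotations [A_y] cost nothing because [D_chan] is a supremum over inputs: [A_y rho A_y^*] is
    again an input, and the replacer sees only the ancilla marginal, which [A_y] leaves unchanged.
    Each term of the mixture is thus at most D_alpha(L || R), and quasi-convexity passes this bound
    to the mixture. Convexity would be too much to ask: for alpha > 1 the divergence is the
    logarithm of a convex functional, and the logarithm only keeps the order. With sigma fixed, the
    sandwich S rho S is linear in rho, so scalar convexity of x^a, - x^a or x ln x suffices, through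
    Tr f. The remaining care goes to infinite values, kernels and ln 0: a finite bound on every term
    first yields the support inclusions or the nonzero traces that make the logarithms
    comparable. *)

Section Spectral.
Variable R : realType.
Local Notation C := (R[i]).
Local Notation mfun := Defs.mfun.

Lemma adjE m n (A : 'M[C]_(m, n)) i j : adj A i j = Num.conj (A j i).
Proof. by rewrite !mxE. Qed.

Lemma adjM m n p (A : 'M[C]_(m, n)) (B : 'M[C]_(n, p)) :
  adj (A *m B) = adj B *m adj A.
Proof. by rewrite /adj trmx_mul map_mxM. Qed.

Lemma adjK m n : cancel (@adj R m n) (@adj R n m).
Proof. by move=> A; apply/matrixP=> i j; rewrite !mxE conjCK. Qed.

Lemma adj1 m : adj (1%:M : 'M[C]_m) = 1%:M.
Proof. by apply/matrixP=> i j; rewrite !mxE rmorph_nat eq_sym. Qed.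

Lemma conj_realC (x : R) : Num.conj (realC x) = realC x.
Proof. by apply/CrealP; apply/complex_realP; exists x. Qed.

Lemma realCE (x : R) : realC x = (x%:C)%C.
Proof. by []. Qed.

Lemma adj_diag_real m (l : 'rV[R]_m) :
  adj (diag_mx (map_mx (@realC R) l)) = diag_mx (map_mx (@realC R) l).
Proof.
apply/matrixP=> i j; rewrite !mxE eq_sym; case: eqP => [->|_].
  by rewrite !mulr1n conj_realC.
by rewrite !mulr0n rmorph0.
Qed.

Lemma unitaryV m (U : 'M[C]_m) : unitary U -> adj U *m U = 1%:M.
Proof. exact: mulmx1C. Qed.

Lemma unitary_adj m (U : 'M[C]_m) : unitary U -> unitary (adj U).
Proof. by move=> /unitaryV; rewrite /unitary adjK. Qed.

Lemma unitaryM m (U V : 'M[C]_m) : unitary U -> unitary V -> unitary (U *m V).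
Proof.
by move=> Uu Vu; rewrite /unitary adjM !mulmxA -(mulmxA U) Vu mulmx1.
Qed.

Lemma spec_decomp_hermitian m (A : 'M[C]_m) :
  adj A = A -> exists U l, spec_decomp A U l.
Proof.
move=> hA.
have Ah : A \is hermsymmx.
  by apply/is_hermitianmxP; rewrite expr0 scale1r; exact: esym hA.
have P1 := spectral_unitarymx A.
have Pu : unitary (adj (spectralmx A)).
  by apply: unitary_adj; apply/unitarymxP.
pose l : 'rV[R]_m := map_mx (@complex.Re R) (spectral_diag A).
have lE : map_mx (@realC R) l = spectral_diag A.
  apply/rowP=> i; rewrite !mxE realCE RRe_real //.
  by have /mxOverP := hermitian_spectral_diag_real Ah; apply.
exists (adj (spectralmx A)), l; split=> //; rewrite adjK lE.
apply: (etrans (orthomx_spectralP (hermitian_normalmx Ah))).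
by rewrite (invmx_unitary P1).
Qed.

(** [psd] only bounds the quadratic form, but [0 <= z] in [C] forces z to be real. Hence the form of
    A - A^* vanishes; this matrix is anti-Hermitian, so normal, and its eigenvalues are values of
    its form at eigenvectors. *)
Lemma psd_adj m (A : 'M[C]_m) : psd A -> adj A = A.
Proof.
move=> pA; pose B := A - adj A.
have Bv (v : 'cV_m) : (adj v *m B *m v) 0 0 = 0.
  have r := pA v; have {}r : (adj v *m A *m v) 0 0 \is Num.real.
    by rewrite realE r.
  rewrite mulmxBr mulmxBl [LHS]mxE [X in _ + X]mxE; apply/eqP.
  rewrite subr_eq0; apply/eqP.
  rewrite -[LHS](CrealP r) -[RHS]/((adj v *m adj A *m v) 0 0).
  have -> : adj v *m adj A *m v = adj (adj v *m A *m v).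
    by rewrite !adjM adjK mulmxA.
  by rewrite !mxE.
have Ba : adj B = - B.
  by apply/matrixP=> i j; rewrite !mxE rmorphB /= conjCK opprB.
have Bn : B \is normalmx.
  apply/normalmxP; rewrite -/(adj B) Ba mulmxN mulNmx //.
have BE := orthomx_spectralP Bn.
have P1 := spectral_unitarymx B.
have Pu : unitary (spectralmx B) by apply/unitarymxP.
suff B0 : B = 0 by apply/esym/eqP; rewrite -subr_eq0 -/B B0.
rewrite BE; suff -> : spectral_diag B = 0 by rewrite linear0 mulmx0 mul0mx.
apply/rowP=> i; rewrite [RHS]mxE.
have := Bv (adj (spectralmx B) *m delta_mx i 0).
rewrite {2}BE invmx_unitary // -/(adj _) adjM adjK.
rewrite !mulmxA -(mulmxA _ (spectralmx B) (adj _)) Pu mulmx1.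
rewrite -(mulmxA _ (spectralmx B) (adj _)) Pu mulmx1.
move=> <-.
rewrite (_ : adj (delta_mx i 0) = delta_mx 0 i :> 'rV[C]_m); last first.
  apply/matrixP=> a b; rewrite !mxE andbC.
  by case: (_ && _); rewrite ?rmorph1 ?rmorph0.
rewrite -rowE -colE.
by rewrite !mxE eqxx.
Qed.

Definition sqnorm (z : C) : R := complex.Re (`|z| ^+ 2).

Lemma sqnormE (z : C) : realC (sqnorm z) = `|z| ^+ 2.
Proof. by rewrite realCE RRe_real // rpredX // normr_real. Qed.

Lemma sqnorm_ge0 (z : C) : 0 <= sqnorm z.
Proof. by rewrite -ler0c -realCE sqnormE exprn_ge0. Qed.

Lemma realC_sum (I : finType) (F : I -> R) : realC (\sum_i F i) = \sum_i realC (F i).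
Proof. by rewrite realCE rmorph_sum. Qed.

Lemma realCM (x y : R) : realC (x * y) = realC x * realC y.
Proof. by rewrite !realCE rmorphM. Qed.

Lemma quad_spec_decomp m (A U : 'M[C]_m) l (v : 'cV_m) : spec_decomp A U l ->
  (adj v *m A *m v) 0 0 = realC (\sum_j sqnorm ((adj U *m v) j 0) * l 0 j).
Proof.
case=> Uu ->; move Ew : (adj U *m v) => w.
have -> : adj v *m (U *m diag_mx (map_mx (@realC R) l) *m adj U) *m v =
  adj w *m diag_mx (map_mx (@realC R) l) *m w.
  by rewrite -Ew adjM adjK !mulmxA.
rewrite realC_sum mxE; apply: eq_bigr => j _.
rewrite realCM sqnormE normCK mul_mx_diag !mxE mulrAC; congr (_ * _); exact: mulrC.
Qed.

Lemma psd_spec_ge0 m (A U : 'M[C]_m) l : spec_decomp A U l -> psd A ->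
  forall i, 0 <= l 0 i.
Proof.
move=> sA pA i; have := pA (U *m delta_mx i 0).
rewrite (quad_spec_decomp _ sA) mulmxA unitaryV; last by case: sA.
rewrite mul1mx realCE ler0c (bigD1 i) //= big1 ?addr0 => [|j ji].
  by rewrite /sqnorm mxE !eqxx normr1 expr1n mul1r.
by rewrite /sqnorm mxE (negbTE ji) normr0 expr0n /= mul0r.
Qed.

(** Independence of the chosen decomposition. The change of basis T = V^* U intertwines the two
    diagonals, so an entry [T i j] is 0 unless the eigenvalues [k i] and [l j] agree; hence T also
    intertwines their images under f. *)
Lemma mfunE (f : R -> R) m (A U : 'M[C]_m) l : spec_decomp A U l ->
  mfun f A = U *m diag_mx (map_mx (fun x => realC (f x)) l) *m adj U.
Proof.
move=> sA; rewrite /mfun; case: pselect => [H|[]]; last by exists (U, l).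
case: (cid H) => -[V k] /= [Vu Ak]; case: sA => Uu Al.
move ET : (adj V *m U) => T.
have TD : T *m diag_mx (map_mx (@realC R) l) = diag_mx (map_mx (@realC R) k) *m T.
  rewrite -ET.
  have -> : adj V *m U *m diag_mx (map_mx (@realC R) l) = adj V *m A *m U.
    by rewrite Al !mulmxA -(mulmxA _ (adj U)) (unitaryV Uu) mulmx1.
  by rewrite Ak !mulmxA (unitaryV Vu) mul1mx.
have Tf : T *m diag_mx (map_mx (fun x => realC (f x)) l) =
          diag_mx (map_mx (fun x => realC (f x)) k) *m T.
  apply/matrixP=> i j; have /matrixP/(_ i j) := TD.
  rewrite !mul_mx_diag !mul_diag_mx !mxE => /eqP.
  rewrite [realC _ * _]mulrC -subr_eq0 -mulrBr mulf_eq0 !realCE.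
  case/orP=> [/eqP ->|]; first by rewrite mul0r mulr0.
  rewrite subr_eq0 => /eqP/complexI ->; exact: mulrC.
have VT : V *m T = U by rewrite -ET mulmxA Vu mul1mx.
rewrite -{1}VT -(mulmxA V T) Tf -!mulmxA; congr (_ *m (_ *m _)).
by rewrite -ET -mulmxA Uu mulmx1.
Qed.

Lemma spec_decomp_conj m (A U W : 'M[C]_m) l : unitary W ->
  spec_decomp A U l -> spec_decomp (W *m A *m adj W) (W *m U) l.
Proof.
by move=> Wu [Uu ->]; split; [exact: unitaryM|rewrite adjM !mulmxA].
Qed.

Lemma unitary_conjK m (A W : 'M[C]_m) : unitary W ->
  adj W *m (W *m A *m adj W) *m W = A.
Proof. by move=> /unitaryV Wu; rewrite !mulmxA Wu mul1mx -mulmxA Wu mulmx1. Qed.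

Lemma mfun_conj f m (A W : 'M[C]_m) : unitary W ->
  mfun f (W *m A *m adj W) = W *m mfun f A *m adj W.
Proof.
move=> Wu.
have [[[U l] /= sA]|nA] :=
  pselect (exists UL : 'M[C]_m * 'rV[R]_m, spec_decomp A UL.1 UL.2).
  rewrite (mfunE f sA) (mfunE f (spec_decomp_conj Wu sA)) adjM !mulmxA //.
(* Without a decomposition [mfun] is 0 on both sides: one of the conjugated matrix would pull back
   to one of A. *)
rewrite /mfun; case: pselect => [[[U l] /= sA]|_]; last first.
  by case: pselect => // _; rewrite mulmx0 mul0mx.
case: nA; exists (adj W *m U, l) => /=.
have := spec_decomp_conj (unitary_adj Wu) sA.
by rewrite adjK unitary_conjK.
Qed.

Lemma mxtrace_conj m (A W : 'M[C]_m) : unitary W -> \tr (W *m A *m adj W) = \tr A.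
Proof. by move=> Wu; rewrite mxtrace_mulC mulmxA unitaryV // mul1mx. Qed.

Lemma mxtrace_mfun f m (A U : 'M[C]_m) l : spec_decomp A U l ->
  \tr (mfun f A) = realC (\sum_i f (l 0 i)).
Proof.
move=> sA; rewrite (mfunE f sA) mxtrace_conj; last by case: sA.
rewrite mxtrace_diag realCE rmorph_sum; apply: eq_bigr => i _.
by rewrite mxE.
Qed.

Lemma adj_mfun f m (A : 'M[C]_m) : adj (mfun f A) = mfun f A.
Proof.
have [[[U l] /= sA]|nA] :=
  pselect (exists UL : 'M[C]_m * 'rV[R]_m, spec_decomp A UL.1 UL.2).
  rewrite (mfunE f sA) !adjM adjK mulmxA; congr (_ *m _ *m _).
  rewrite (_ : map_mx _ l = map_mx (@realC R) (map_mx f l)) ?adj_diag_real //.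
  by apply/rowP=> i; rewrite !mxE.
rewrite /mfun; case: pselect => // _.
by apply/matrixP=> i j; rewrite !mxE rmorph0.
Qed.

Lemma psd_conj m n (A : 'M[C]_m) (B : 'M[C]_(n, m)) :
  psd A -> psd (B *m A *m adj B).
Proof.
move=> pA v; have := pA (adj B *m v).
by rewrite adjM adjK !mulmxA.
Qed.

Lemma psd_sum m (I : finType) (w : I -> R) (A : I -> 'M[C]_m) :
  (forall i, 0 <= w i) -> (forall i, psd (A i)) ->
  psd (\sum_i realC (w i) *: A i).
Proof.
move=> w0 pA v; rewrite mulmx_sumr mulmx_suml summxE; apply: sumr_ge0 => i _.
rewrite -scalemxAr -scalemxAl mxE; apply: mulr_ge0; last exact: pA.
by rewrite realCE ler0c.
Qed.

Lemma psd_factor m (A : 'M[C]_m) : psd A -> exists T : 'M[C]_m, A = adj T *m T.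
Proof.
move=> pA; have [U [l sA]] := spec_decomp_hermitian (psd_adj pA).
have l0 := psd_spec_ge0 sA pA; case: sA => _ ->.
pose D := diag_mx (map_mx (@realC R) (map_mx Num.sqrt l)).
exists (D *m adj U); rewrite adjM adjK adj_diag_real !mulmxA; congr (_ *m _).
rewrite -mulmxA mulmx_diag; congr (_ *m diag_mx _); apply/rowP=> i.
by rewrite !mxE -realCM -expr2 sqr_sqrtr.
Qed.

Lemma mxtrace_adjM_eq0 m n (A : 'M[C]_(m, n)) : \tr (adj A *m A) = 0 -> A = 0.
Proof.
move=> tA; apply/matrixP=> i j; rewrite [RHS]mxE.
have H (k : 'I_n) : (adj A *m A) k k = \sum_i `|A i k| ^+ 2.
  rewrite mxE; apply: eq_bigr => h _; rewrite !mxE normCK; exact: mulrC.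
have p0 (k : 'I_n) (h : 'I_m) : 0 <= `|A h k| ^+ 2 by exact: exprn_ge0.
move: tA; rewrite /mxtrace (eq_bigr _ (fun k _ => H k)).
move/eqP; rewrite psumr_eq0 => [|k _]; last exact: sumr_ge0.
move=> /allP/(_ j); rewrite mem_index_enum => /(_ isT) /=.
rewrite psumr_eq0 // => /allP/(_ i); rewrite mem_index_enum => /(_ isT) /=.
by rewrite expf_eq0 /= normr_eq0 => /eqP.
Qed.

End Spectral.

(** * Quasi-convexity of the sandwiched Renyi divergences *)

Section Entropy.
Variable R : realType.
Local Notation C := (R[i]).
Local Notation mfun := Defs.mfun.

(* A convex function on [0, +oo[ vanishing at 0 need not have a supporting
   line at 0 (e.g. - x ^ a with a < 1), hence the restriction to 0 < c. *)
Definition supported (f : R -> R) : Prop :=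
  f 0 = 0 /\
  forall c, 0 < c -> exists s, forall x, 0 <= x -> f c + s * (x - c) <= f x.

Lemma supported_jensen f (I : finType) (w x : I -> R) : supported f ->
  (forall i, 0 <= w i) -> \sum_i w i = 1 -> (forall i, 0 <= x i) ->
  f (\sum_i w i * x i) <= \sum_i w i * f (x i).
Proof.
move=> [f0 fs] w0 w1 x0; set c := \sum_i _.
have wx0 i : 0 <= w i * x i by exact: mulr_ge0.
have : 0 <= c by exact: sumr_ge0.
rewrite le_eqVlt => /orP[/eqP c0|/fs[s Hs]].
  (* Mean zero: every product [w i * x i] is zero, so [f 0 = 0] kills each term and no supporting
     line is used. *)
  rewrite -c0 f0 sumr_ge0 // => i _.
  have /eqP := esym c0; rewrite psumr_eq0 // => /allP/(_ i).
  rewrite mem_index_enum => /(_ isT) /=; rewrite mulf_eq0 => /orP[]/eqP ->.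
    by rewrite mul0r.
  by rewrite f0 mulr0.
have <- : \sum_i w i * (f c + s * (x i - c)) = f c.
  under eq_bigr do rewrite mulrDr mulrCA mulrBr.
  rewrite big_split /= -mulr_suml w1 mul1r -mulr_sumr sumrB -mulr_suml w1 mul1r.
  by rewrite subrr mulr0 addr0.
by apply: ler_sum => i _; rewrite ler_wpM2l // Hs.
Qed.

(** Turns a convexity inequality into quasi-convexity by singling out one component that dominates
    the mixture. *)
Lemma convex_mean_le (I : finType) (w b : I -> R) a :
  (forall i, 0 <= w i) -> \sum_i w i = 1 -> a <= \sum_i w i * b i ->
  exists i, a <= b i.
Proof.
move=> w0 w1 ab; apply: contrapT => /forallNP nab.
have lt i : b i < a by rewrite ltNge; apply/negP/nab.
have: \sum_i w i * (a - b i) == 0.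
  rewrite eq_le sumr_ge0 ?andbT => [|i _].
    under eq_bigr do rewrite mulrBr.
    by rewrite sumrB -mulr_suml w1 mul1r subr_le0.
  by rewrite mulr_ge0 // subr_ge0 ltW.
rewrite psumr_eq0 => [/allP H|i _]; last by rewrite mulr_ge0 // subr_ge0 ltW.
move/eqP: w1; rewrite big1 ?(eq_sym 0) ?oner_eq0 // => i _.
have := H i; rewrite mem_index_enum => /(_ isT) /=.
by rewrite mulf_eq0 subr_eq0 (gt_eqF (lt i)) orbF => /eqP.
Qed.

Lemma sqnorm_unitary_col m (T : 'M[C]_m) j : unitary T ->
  \sum_h sqnorm (T h j) = 1.
Proof.
move=> /unitaryV/matrixP/(_ j j); rewrite !mxE eqxx => H.
apply: (@complexI R); rewrite -!realCE realC_sum realCE /= -[RHS]H.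
apply: eq_bigr => h _; rewrite sqnormE !mxE normCK; exact: mulrC.
Qed.

Lemma sqnorm_unitary_row m (T : 'M[C]_m) h : unitary T ->
  \sum_j sqnorm (T h j) = 1.
Proof.
move=> /matrixP/(_ h h); rewrite !mxE eqxx => H.
apply: (@complexI R); rewrite -!realCE realC_sum realCE /= -[RHS]H.
by apply: eq_bigr => j _; rewrite sqnormE !mxE normCK.
Qed.

Definition trfun f m (A : 'M[C]_m) : R := complex.Re (\tr (mfun f A)).

Lemma trfunE f m (A U : 'M[C]_m) l : spec_decomp A U l ->
  trfun f A = \sum_i f (l 0 i).
Proof. by move=> sA; rewrite /trfun (mxtrace_mfun f sA). Qed.

Lemma trfunN f m (A : 'M[C]_m) : psd A ->
  trfun (fun x => - f x) A = - trfun f A.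
Proof.
move=> /psd_adj/spec_decomp_hermitian[U [l sA]].
by rewrite !(trfunE _ sA) sumrN.
Qed.

(* Peierls' argument: the eigenvalues of the mixture are themselves convex
   combinations, with doubly stochastic weights, of those of the [A i]. *)
Lemma trfun_convex f m (I : finType) (w : I -> R) (A : I -> 'M[C]_m) :
  supported f -> (forall i, 0 <= w i) -> \sum_i w i = 1 ->
  (forall i, psd (A i)) ->
  trfun f (\sum_i realC (w i) *: A i) <= \sum_i w i * trfun f (A i).
Proof.
move=> sf w0 w1 pA.
have [U [l sM]] := spec_decomp_hermitian (psd_adj (psd_sum w0 pA)).
have /boolp.choice[VK HVK] : forall i, exists VK : 'M[C]_m * 'rV[R]_m,
    spec_decomp (A i) VK.1 VK.2.
  move=> i; have [V [k ?]] := spec_decomp_hermitian (psd_adj (pA i)).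
  by exists (V, k).
have Uu : unitary U by case: sM.
have Vu i : unitary (VK i).1 by case: (HVK i).
(* Squared overlap of eigenvector h of [A i] with eigenvector j of the mixture. Unitarity makes it
   sum to 1 over h, which gives Jensen its weights, and over j, which collapses the final double
   sum. *)
pose p i j h := sqnorm ((adj (VK i).1 *m U) h j).
have lE j : l 0 j = \sum_ih (w ih.1 * p ih.1 j ih.2) * (VK ih.1).2 0 ih.2.
  apply: (@complexI R); rewrite -!realCE.
  transitivity ((adj (col j U) *m (\sum_i realC (w i) *: A i) *m col j U) 0 0).
    rewrite (quad_spec_decomp _ sM) colE mulmxA unitaryV // mul1mx.
    rewrite (bigD1 j) //= big1 ?addr0 => [|i ij].
      by rewrite /sqnorm mxE !eqxx normr1 expr1n mul1r.
    by rewrite /sqnorm mxE (negbTE ij) normr0 expr0n /= mul0r.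
  rewrite -(pair_bigA _ (fun i h => w i * p i j h * (VK i).2 0 h)) /=.
  rewrite realC_sum mulmx_sumr mulmx_suml summxE; apply: eq_bigr => i _.
  rewrite -scalemxAr -scalemxAl mxE (quad_spec_decomp _ (HVK i)).
  rewrite -realCM mulr_sumr; congr (realC _); apply: eq_bigr => h _.
  by rewrite mulrA /p !colE mulmxA -colE mxE.
rewrite (trfunE f sM) (eq_bigr _ (fun i _ => congr1 _ (trfunE f (HVK i)))).
pose F j := \sum_ih (w ih.1 * p ih.1 j ih.2) * f ((VK ih.1).2 0 ih.2).
apply: (@le_trans _ _ (\sum_j F j)).
  apply: ler_sum => j _; rewrite lE; apply: supported_jensen => //.
  - by move=> [i h] /=; rewrite mulr_ge0 // sqnorm_ge0.
  - rewrite -(pair_bigA _ (fun i h => w i * p i j h)) /= -[RHS]w1.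
    apply: eq_bigr => i _; rewrite -mulr_sumr sqnorm_unitary_col ?mulr1 //.
    by apply: unitaryM => //; exact: unitary_adj.
  - by move=> [i h] /=; apply: (psd_spec_ge0 (HVK i)).
rewrite /F exchange_big /=.
rewrite -(pair_bigA _ (fun i h => \sum_j w i * p i j h * f ((VK i).2 0 h))) /=.
apply: ler_sum => i _; rewrite mulr_sumr; apply: ler_sum => h _.
rewrite -mulr_suml -mulr_sumr sqnorm_unitary_row ?mulr1 //.
by apply: unitaryM => //; exact: unitary_adj.
Qed.

(** After taking logarithms this is a ln t <= ln m, where m is the mean of t and 1 with weights a
    and 1 - a. Add ln y <= y - 1 at y = t / m and at y = 1 / m with these weights: the right-hand
    sides cancel. *)
Lemma powR_tangent_concave (a t : R) : 0 < a < 1 -> 0 < t ->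
  powR t a <= 1 + a * (t - 1).
Proof.
move=> /andP[a0 a1] t0; set m := 1 + _.
have m0 : 0 < m by rewrite /m; nra.
have lnle (y : R) : 0 < y -> ln y <= y - 1.
  move=> y0; have := @le_ln1Dx R (y - 1).
  by rewrite (addrC 1) subrK; apply; lra.
rewrite -ler_ln ?posrE ?powR_gt0 // ln_powR.
have h1 := lnle (t / m) (divr_gt0 t0 m0).
have h2 : ln m^-1 <= m^-1 - 1 by apply: lnle; rewrite invr_gt0.
move: h1 h2; rewrite ln_div ?posrE // lnV ?posrE //.
set lt := ln t; set lm := ln m => h1 h2.
have e : a * (t / m - 1) + (1 - a) * (m^-1 - 1) = 0.
  by rewrite /m; field; rewrite -/m gt_eqF.
nra.
Qed.

(** The concave case for the exponent 1 / a at the point t ^ a. *)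
Lemma powR_tangent_convex (a t : R) : 1 < a -> 0 < t ->
  1 + a * (t - 1) <= powR t a.
Proof.
move=> a1 t0; have a0 : 0 < a by lra.
have := @powR_tangent_concave a^-1 (powR t a).
rewrite invr_gt0 a0 invf_lt1 // a1 powR_gt0 // => /(_ isT isT).
rewrite -powRrM mulfV ?gt_eqF // powRr1 ?(ltW t0) //.
set u := powR t a => h.
have : a * t <= a * (1 + a^-1 * (u - 1)) by rewrite ler_pM2l.
rewrite mulrDr mulr1 mulrA mulfV ?gt_eqF // mul1r; lra.
Qed.

Lemma pospow0 (a : R) : pospow a 0 = 0.
Proof. by rewrite /pospow ltxx. Qed.

Lemma pospow_ge0 (a x : R) : 0 <= pospow a x.
Proof. by rewrite /pospow; case: ifP => // _; exact: powR_ge0. Qed.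

Lemma pospow_gt0 (a x : R) : 0 < x -> 0 < pospow a x.
Proof. by move=> x0; rewrite /pospow x0 powR_gt0. Qed.

Lemma powR_scale (a c x : R) : 0 < c -> 0 <= x ->
  powR x a = powR c a * powR (x / c) a.
Proof.
move=> c0 x0; rewrite -powRM ?divr_ge0 ?(ltW c0) //.
by rewrite mulrCA mulfV ?mulr1 ?gt_eqF.
Qed.

Lemma supported_pospow_convex (a : R) : 1 < a -> supported (pospow a).
Proof.
move=> a1; split=> [|c c0]; first exact: pospow0.
(* The derivative a c ^ (a - 1), written so that factoring out c ^ a leaves the tangent at 1. The
   point x = 0 is treated apart, [pospow] being defined there by convention. *)
exists (powR c a * a / c) => x.
have e : powR c a + powR c a * a / c * (x - c) = powR c a * (1 + a * (x / c - 1)).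
  by field; rewrite gt_eqF.
rewrite le_eqVlt => /predU1P[<-|x0].
  rewrite pospow0 /pospow c0 sub0r mulrN mulfVK ?gt_eqF //.
  have := powR_gt0 a c0; nra.
rewrite /pospow c0 x0 e (powR_scale a c0 (ltW x0)) ler_wpM2l ?powR_ge0 //.
by apply: powR_tangent_convex => //; rewrite divr_gt0.
Qed.

Lemma supported_pospow_concave (a : R) : 0 < a < 1 ->
  supported (fun x => - pospow a x).
Proof.
move=> a01; split=> [|c c0]; first by rewrite pospow0 oppr0.
exists (- (powR c a * a / c)) => x.
have e : - powR c a + - (powR c a * a / c) * (x - c)
         = - (powR c a * (1 + a * (x / c - 1))).
  by field; rewrite gt_eqF.
rewrite le_eqVlt => /predU1P[<-|x0].
  rewrite pospow0 /pospow c0 sub0r mulrNN mulfVK ?gt_eqF //.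
  have := powR_gt0 a c0; case/andP: a01; nra.
rewrite /pospow c0 x0 e (powR_scale a c0 (ltW x0)) lerN2 ler_wpM2l ?powR_ge0 //.
by apply: powR_tangent_concave => //; rewrite divr_gt0.
Qed.

Lemma supported_xlnx : supported (fun x => x * poslog x).
Proof.
split=> [|c c0]; first by rewrite mul0r.
(* Slope of x ln x at c; the tangent inequality is x times ln y <= y - 1 at y = c / x. *)
exists (ln c + 1) => x; rewrite le_eqVlt => /predU1P[<-|x0].
  by rewrite mul0r /poslog c0; lra.
rewrite /poslog c0 x0.
have : ln (c / x) <= c / x - 1.
  have cx := divr_gt0 c0 x0; have := @le_ln1Dx R (c / x - 1).
  by rewrite (addrC 1) subrK; apply; lra.
rewrite ln_div ?posrE // => h.
have : x * (ln c - ln x) <= x * (c / x - 1) by rewrite ler_pM2l.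
rewrite [X in _ <= X]mulrBr mulrCA mulfV ?gt_eqF // !mulr1; nra.
Qed.

Lemma Re_sub (x y : C) : complex.Re (x - y) = complex.Re x - complex.Re y.
Proof. by case: x y => a b [c d]. Qed.

Lemma Re_sum (I : finType) (F : I -> C) :
  complex.Re (\sum_i F i) = \sum_i complex.Re (F i).
Proof. by apply: big_morph => // -[a b] [c d]. Qed.

Lemma mxtrace_mul_poslog m (A : 'M[C]_m) : psd A ->
  complex.Re (\tr (A *m mfun (@poslog R) A)) = trfun (fun x => x * poslog x) A.
Proof.
move=> /psd_adj/spec_decomp_hermitian[U [l sA]].
rewrite (trfunE _ sA) (mfunE _ sA); case: (sA) => Uu {1}->.
rewrite !mulmxA -(mulmxA _ (adj U) U) unitaryV // mulmx1 -(mulmxA U).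
rewrite mxtrace_conj // mulmx_diag mxtrace_diag.
rewrite [X in complex.Re X](_ : _ = realC (\sum_i l 0 i * poslog (l 0 i))) //.
by rewrite realC_sum; apply: eq_bigr => i _; rewrite !mxE realCM.
Qed.

Lemma psd_sandwich f m (rho sigma : 'M[C]_m) : psd rho ->
  psd (mfun f sigma *m rho *m mfun f sigma).
Proof. by move=> pr; rewrite -{2}(adj_mfun f sigma); exact: psd_conj. Qed.

Lemma sandQE a m (rho sigma : 'M[C]_m) :
  sandQ a rho sigma = trfun (pospow a)
   (mfun (pospow ((1 - a) / (2 * a))) sigma *m rho *m
    mfun (pospow ((1 - a) / (2 * a))) sigma).
Proof. by []. Qed.

Lemma trfun_pospow_ge0 a m (A : 'M[C]_m) : psd A -> 0 <= trfun (pospow a) A.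
Proof.
move=> /psd_adj/spec_decomp_hermitian[U [l sA]]; rewrite (trfunE _ sA).
by apply: sumr_ge0 => i _; exact: pospow_ge0.
Qed.

Lemma trfun_pospow_eq0 a m (A : 'M[C]_m) : psd A -> trfun (pospow a) A = 0 -> A = 0.
Proof.
move=> pA; have [U [l sA]] := spec_decomp_hermitian (psd_adj pA).
have l0 := psd_spec_ge0 sA pA.
rewrite (trfunE _ sA) => /eqP; rewrite psumr_eq0 => [/allP H|i _]; last first.
  exact: pospow_ge0.
have -> : A = U *m diag_mx (map_mx (@realC R) l) *m adj U by case: sA.
rewrite (_ : map_mx _ l = 0) ?linear0 ?mulmx0 ?mul0mx //.
apply/rowP=> i; rewrite !mxE.
have := H i; rewrite mem_index_enum => /(_ isT) /=.
have := l0 i; rewrite le_eqVlt => /predU1P[<-//|/(pospow_gt0 a) h].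
by rewrite gt_eqF.
Qed.

(** Allows [ln] to be compared on the mixture when a > 1. If the trace vanished, so would S rho S.
    In an eigenbasis of sigma, the diagonal entries of rho are then 0 where the eigenvalue is
    positive, and support inclusion kills the rows where it is 0, against Tr rho = 1. *)
Lemma sandQ_gt0 a m (rho sigma : 'M[C]_m) : is_state rho -> psd sigma ->
  supp_incl rho sigma -> 0 < sandQ a rho sigma.
Proof.
move=> [pr tr1] ps inc; rewrite sandQE; set p := (1 - a) / _.
rewrite lt_neqAle trfun_pospow_ge0 ?andbT; last exact: psd_sandwich.
apply/eqP => /esym/trfun_pospow_eq0 => /(_ (psd_sandwich _ _ pr)).
have [U [s ss]] := spec_decomp_hermitian (psd_adj ps).
have s0 := psd_spec_ge0 ss ps; have [Uu sE] := ss.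
rewrite (mfunE _ ss) => E0.
have /eqP := oner_neq0 C; apply; rewrite -tr1 -(mxtrace_conj rho (unitary_adj Uu)) adjK.
pose D := diag_mx (map_mx (fun x => realC (pospow p x)) s).
have {E0} : D *m (adj U *m rho *m U) *m D = 0.
  have := congr1 (fun X => adj U *m X *m U) E0.
  rewrite mulmx0 mul0mx !mulmxA unitaryV // mul1mx.
  by rewrite -(mulmxA _ (adj U) U) unitaryV // mulmx1.
have supp i : s 0 i = 0 -> row i (adj U *m rho *m U) = 0.
  move=> si0; rewrite row_mul row_mul inc ?mul0mx //.
  rewrite sE !mulmxA -row_mul unitaryV // row1 -rowE row_diag_mx mxE si0.
  by rewrite realCE /= scale0r mul0mx.
move: supp; move: (adj U *m rho *m U) => Y supp E0.
rewrite /mxtrace big1 // => i _.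
have := s0 i; rewrite le_eqVlt => /predU1P[si0|si0].
  by have /rowP/(_ i) := supp i (esym si0); rewrite !mxE.
have /matrixP/(_ i i) := E0; rewrite mul_mx_diag [LHS]mxE mul_diag_mx !mxE.
move/eqP; rewrite !mulf_eq0.
have h : realC (pospow p (s 0 i)) == 0 = false.
  rewrite realCE; apply/negbTE; apply/eqP => /complexI/eqP.
  by rewrite gt_eqF // pospow_gt0.
by rewrite h orbF /= => /eqP.
Qed.

Lemma ln_le (x y : R) : 0 < x -> x <= y -> ln x <= ln y.
Proof. by move=> x0 xy; rewrite ler_ln // posrE // (lt_le_trans x0). Qed.

(** * Mixtures of states against a fixed second argument *)

Section Mixture.
Variables (m : nat) (I : finType) (w : I -> R) (rho : I -> 'M[C]_m).
Variable sigma : 'M[C]_m.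
Hypotheses (w0 : forall i, 0 <= w i) (w1 : \sum_i w i = 1).
Hypothesis (rho_state : forall i, is_state (rho i)).
Hypothesis (sigma_psd : psd sigma).
Local Notation mix := (\sum_i realC (w i) *: rho i).

Lemma mix_state : is_state mix.
Proof.
split; first by apply: psd_sum => // i; case: (rho_state i).
rewrite raddf_sum /= -[RHS]/(realC 1) -w1 realC_sum; apply: eq_bigr => i _.
by rewrite mxtraceZ; case: (rho_state i) => _ ->; rewrite mulr1.
Qed.

Lemma mix_supp : (forall i, supp_incl (rho i) sigma) -> supp_incl mix sigma.
Proof.
move=> inc v vs; rewrite mulmx_sumr big1 // => i _.
by rewrite -scalemxAr inc ?scaler0.
Qed.

Lemma mix_sandwich (S : 'M[C]_m) :
  S *m mix *m S = \sum_i realC (w i) *: (S *m rho i *m S).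
Proof.
rewrite mulmx_sumr mulmx_suml; apply: eq_bigr => i _.
by rewrite -scalemxAr -scalemxAl.
Qed.

Lemma sandQ_convex a : 1 < a ->
  sandQ a mix sigma <= \sum_i w i * sandQ a (rho i) sigma.
Proof.
move=> a1; rewrite sandQE mix_sandwich.
apply: trfun_convex => // [|i]; first exact: supported_pospow_convex.
by apply: psd_sandwich; case: (rho_state i).
Qed.

Lemma sandQ_concave a : 0 < a < 1 ->
  \sum_i w i * sandQ a (rho i) sigma <= sandQ a mix sigma.
Proof.
move=> a1; rewrite sandQE mix_sandwich.
have pS i := @psd_sandwich (pospow ((1 - a) / (2 * a))) m (rho i) sigma
  (proj1 (rho_state i)).
rewrite -lerN2 -trfunN; last exact: psd_sum.
apply: le_trans (trfun_convex (supported_pospow_concave a1) w0 w1 pS) _.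
rewrite -sumrN; apply: ler_sum => i _.
by rewrite trfunN // mulrN.
Qed.

Lemma D_fin_quasiconvex a B : 0 < a -> a != 1 ->
  (forall i, D_fin a (rho i) sigma <= B)%E -> (D_fin a mix sigma <= B)%E.
Proof.
move=> a0 a1 DB; have [->|Bfin] := eqVneq B +oo%E; first exact: leey.
have {}DB i : (D_fin a (rho i) sigma <= B)%E /\ D_fin a (rho i) sigma != +oo%E.
  split=> //; apply: contra Bfin => /eqP h; rewrite -leye_eq -h; exact: DB.
have Q0 i : 0 <= sandQ a (rho i) sigma.
  by rewrite sandQE trfun_pospow_ge0 //; apply: psd_sandwich; case: (rho_state i).
case: (ltgtP a 1) a1 => // a1 _.
  (* For a < 1 the trace is concave and the factor 1 / (a - 1) negative, so the dominating component
     is one whose trace is at most that of the mixture. *)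
  have [|i Qi] := convex_mean_le w0 w1 (a := - sandQ a mix sigma)
      (b := fun i => - sandQ a (rho i) sigma).
    under [X in _ <= X]eq_bigr do rewrite mulrN.
    by rewrite sumrN lerN2 sandQ_concave // a0.
  move: Qi; rewrite lerN2 => Qi.
  have [Di Dfin] := DB i.
  have Qi0 : sandQ a (rho i) sigma != 0.
    by apply: contra Dfin => Qi0; rewrite /D_fin a1 Qi0.
  have Qi_gt0 : 0 < sandQ a (rho i) sigma by rewrite lt_neqAle eq_sym Qi0 Q0.
  have Q_gt0 := lt_le_trans Qi_gt0 Qi.
  apply: le_trans _ Di.
  rewrite /D_fin a1 (gt_eqF Q_gt0) (negbTE Qi0) lee_fin.
  apply: ler_wnM2l; first by rewrite invr_le0 subr_le0 ltW.
  exact: ln_le Qi_gt0 Qi.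
have a1F : a < 1 = false by rewrite ltNge (ltW a1).
have inc i : supp_incl (rho i) sigma.
  by have [_] := DB i; rewrite /D_fin a1F; case: asboolP.
have [i Qi] := convex_mean_le w0 w1 (sandQ_convex a1).
have [Di _] := DB i; apply: le_trans _ Di.
rewrite /D_fin a1F; case: asboolP => [_|[]]; last exact: mix_supp.
case: asboolP => [_|[]]; last exact: inc.
rewrite lee_fin.
apply: ler_wpM2l; first by rewrite invr_ge0 subr_ge0 ltW.
apply: ln_le Qi; apply: sandQ_gt0; first exact: mix_state; last exact: mix_supp.
exact: sigma_psd.
Qed.

(** With supports included, the relative entropy is the convex trace function Tr rho ln rho minus
    the term [T], which is linear in rho. *)
Lemma D_one_quasiconvex B :
  (forall i, D_one (rho i) sigma <= B)%E -> (D_one mix sigma <= B)%E.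
Proof.
move=> DB; have [->|Bfin] := eqVneq B +oo%E; first exact: leey.
have inc i : supp_incl (rho i) sigma.
  have := DB i; rewrite /D_one; case: asboolP => // _.
  by rewrite leye_eq (negbTE Bfin).
have pr i : psd (rho i) by case: (rho_state i).
pose G r := complex.Re (\tr (r *m (mfun (@poslog R) r - mfun (@poslog R) sigma))).
pose T r := complex.Re (\tr (r *m mfun (@poslog R) sigma)).
have GE r : psd r -> G r = trfun (fun x => x * poslog x) r - T r.
  by move=> p; rewrite /G /T -mxtrace_mul_poslog // mulmxBr
    (raddfB (@mxtrace C m)) Re_sub.
have TE : T mix = \sum_i w i * T (rho i).
  rewrite /T mulmx_suml (raddf_sum (@mxtrace C m)) Re_sum; apply: eq_bigr => i _ /=.
  rewrite -scalemxAl mxtraceZ realCE.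
  by case: (\tr _) => x y /=; rewrite mul0r subr0.
have [i Gi] : exists i, G mix <= G (rho i).
  apply: (convex_mean_le w0 w1); rewrite GE ?TE; last by case: mix_state.
  under [X in _ <= X]eq_bigr do rewrite GE // mulrBr.
  by rewrite sumrB lerB // trfun_convex //; exact: supported_xlnx.
apply: le_trans _ (DB i); rewrite /D_one.
case: asboolP => [_|[]]; last exact: mix_supp.
by case: asboolP => [_|[]]; [rewrite lee_fin|exact: inc].
Qed.

(** Rather than have the infimum attained, the proof takes any real b > B: every component has an
    admissible l < e^b, and e^b is then admissible for all of them at once, hence for their
    average. *)
Lemma D_max_quasiconvex B :
  (forall i, D_max (rho i) sigma <= B)%E -> (D_max mix sigma <= B)%E.
Proof.
move=> DB.
have key b : (B < b%:E)%E -> (D_max mix sigma <= b%:E)%E.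
  move=> Bb; apply: ereal_inf_lbound; exists (expR b); last by rewrite expRK.
  split; first exact: expR_gt0.
  have pi i : psd (realC (expR b) *: sigma - rho i).
    have := le_lt_trans (DB i) Bb.
    move/ereal_inf_lt => [_ [l [l0 pl] <-]]; rewrite lte_fin => lb.
    (* Raising l to e^b adds (e^b - l) sigma; the sum over [bool] only puts the two terms in the
       form of [psd_sum]. *)
    have -> : realC (expR b) *: sigma - rho i =
      \sum_(k : bool) realC (if k then 1 else expR b - l) *:
         (if k then realC l *: sigma - rho i else sigma).
      rewrite big_bool /= scale1r addrAC -scalerDl !realCE -rmorphD /=.
      by rewrite [l + _]addrC subrK.
    apply: psd_sum => -[] //.
    by rewrite subr_ge0 -[l]lnK ?posrE // ler_expR ltW.
  have -> : realC (expR b) *: sigma - mix =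
      \sum_i realC (w i) *: (realC (expR b) *: sigma - rho i).
    under [RHS]eq_bigr do rewrite scalerBr.
    by rewrite sumrB -scaler_suml -realC_sum w1 scale1r.
  exact: psd_sum.
apply/lee_addgt0Pr => e e0; move: key; case: B DB => [b|//|] DB key.
- by rewrite -EFinD; apply: key; rewrite lte_fin ltrDl.
- exact: leey.
(* B = -oo: the bound -1 rules out +oo, and a real value x would be at most x - 1. *)
- rewrite leNgt; apply/negP => h.
  have : (D_max mix sigma <= (-1)%:E)%E by apply: key; exact: ltNyr.
  case E: (D_max mix sigma) h => [x|//|//] _ _.
  have := key (x - 1) (ltNyr _); rewrite E lee_fin; lra.
Qed.

Lemma D_alpha_quasiconvex alpha B : ((2^-1 : R)%:E <= alpha)%E ->
  (forall i, D_alpha alpha (rho i) sigma <= B)%E ->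
  (D_alpha alpha mix sigma <= B)%E.
Proof.
case: alpha => [a|_|//] /=; last exact: D_max_quasiconvex.
rewrite lee_fin => a2; case: eqP => [_|/eqP a1]; first exact: D_one_quasiconvex.
by apply: D_fin_quasiconvex => //; apply: lt_le_trans a2; rewrite invr_gt0.
Qed.

End Mixture.

(** * Invariance of the divergences under a common unitary *)

Section UnitaryInvariance.
Variables (m : nat) (W : 'M[C]_m).
Hypothesis Wu : unitary W.
Local Notation cj X := (W *m X *m adj W).

Lemma unitary_conjM (A B : 'M[C]_m) : cj A *m cj B = cj (A *m B).
Proof. by rewrite !mulmxA -(mulmxA _ (adj W) W) (unitaryV Wu) mulmx1. Qed.

Lemma supp_incl_conj (rho sigma : 'M[C]_m) :
  supp_incl rho sigma -> supp_incl (cj rho) (cj sigma).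
Proof.
move=> inc v vs; rewrite !mulmxA inc ?mul0mx //.
have := congr1 (mulmx^~ W) vs.
by rewrite mul0mx -!mulmxA unitaryV // mulmx1.
Qed.

Lemma psd_conjE (A : 'M[C]_m) : psd (cj A) <-> psd A.
Proof.
split; last exact: psd_conj.
by move/(psd_conj (adj W)); rewrite adjK unitary_conjK.
Qed.

Lemma D_alpha_conj alpha (rho sigma : 'M[C]_m) :
  D_alpha alpha (cj rho) (cj sigma) = D_alpha alpha rho sigma.
Proof.
have incE : `[< supp_incl (cj rho) (cj sigma) >] = `[< supp_incl rho sigma >].
  apply/asboolP/asboolP => [inc v vs|]; last exact: supp_incl_conj.
  have := inc (v *m adj W); rewrite !mulmxA -(mulmxA v) unitaryV // mulmx1 vs mul0mx.
  move=> /(_ erefl)/(congr1 (mulmx^~ W)).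
  by rewrite mul0mx -mulmxA unitaryV // mulmx1.
have mfE f X := @mfun_conj R f m X W Wu.
case: alpha => [a| |]; rewrite /D_alpha; last by [].
- have -> : D_one (cj rho) (cj sigma) = D_one rho sigma.
    rewrite /D_one incE !mfE -mulmxBl -mulmxBr unitary_conjM.
    by rewrite (mxtrace_conj _ Wu).
  suff E : sandQ a (cj rho) (cj sigma) = sandQ a rho sigma.
    by rewrite /D_fin incE E.
  by rewrite /sandQ mfE !unitary_conjM mfE (mxtrace_conj _ Wu).
- have E l : psd (realC l *: cj sigma - cj rho) = psd (realC l *: sigma - rho).
    rewrite scalemxAl scalemxAr -mulmxBl -mulmxBr; apply/propext; exact: psd_conjE.
  have setE : [set l : R | 0 < l /\ psd (realC l *: cj sigma - cj rho)]%classic =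
              [set l | 0 < l /\ psd (realC l *: sigma - rho)]%classic.
    by apply/funext => l /=; rewrite E.
  by rewrite /D_max setE.
Qed.

End UnitaryInvariance.

End Entropy.

(** * Weyl operators and the mean state *)

Section Weyl.
Variable R : realType.
Local Notation C := (R[i]).
Variable d' : nat.
Local Notation d := d'.+1.
Local Notation chi := (chi R d).
Local Notation h := (d.+1./2%:Z).

Lemma chiD a b : chi (a + b) = chi a * chi b.
Proof.
rewrite /Defs.chi rmorphD /= mulrDr mulrDl cosD sinD.
apply/eqP; rewrite eq_complex /=; apply/andP; split=> //.
by rewrite addrC.
Qed.

Lemma chi0 : chi 0 = 1.
Proof. by rewrite /Defs.chi mulr0 mul0r cos0 sin0. Qed.

Lemma chiVN a : chi a * chi (- a) = 1.
Proof. by rewrite -chiD subrr chi0. Qed.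

Lemma conj_chi a : Num.conj (chi a) = chi (- a).
Proof. by rewrite /Defs.chi rmorphN mulrN mulNr cosN sinN. Qed.

Lemma norm_chi a : `|chi a| = 1.
Proof.
apply/eqP; rewrite -(@eqrXn2 _ 2) // ?normr_ge0 //.
by rewrite normCK conj_chi chiVN expr1n.
Qed.

Lemma chi_sum (I : finType) (F : I -> int) : chi (\sum_i F i) = \prod_i chi (F i).
Proof. by apply: (big_morph chi chiD chi0). Qed.

Lemma chiMn (a : int) (n : nat) : chi (n%:Z * a) = chi a ^+ n.
Proof.
elim: n => [|n IH]; first by rewrite mul0r chi0.
by rewrite (intS n) mulrDl chiD IH mul1r exprS.
Qed.

Lemma chi_period a : (d%:Z %| a)%Z -> chi a = 1.
Proof.
have chid : chi d%:Z = 1.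
  rewrite /Defs.chi -[(d%:Z)%:~R]/(d%:R : R) mulfK ?pnatr_eq0 //.
  by rewrite mulr_natl cos2pi sin2pi.
case/dvdzP => -[] n ->; first by rewrite chiMn chid expr1n.
by rewrite NegzE mulNr -[LHS]mul1r -(chiVN (n.+1%:Z * d%:Z)) mulrAC -mulrA -conj_chi
  chiMn chid expr1n rmorph1 !mulr1.
Qed.

Lemma chi_congr a b : (d%:Z %| a - b)%Z -> chi a = chi b.
Proof. by move=> /chi_period ab; rewrite -(subrK b a) chiD ab mul1r. Qed.

(* [chi a = cos 2t + i sin 2t = 1] forces [sin t = 0], with [0 < t < pi]. *)
Lemma chi_neq1 a : ~~ (d%:Z %| a)%Z -> chi a != 1.
Proof.
move=> nda; pose r := (a %% d%:Z)%Z.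
have -> : chi a = chi r.
  apply: chi_congr; rewrite {1}(divz_eq a d%:Z) -/r addrK; exact: dvdz_mull.
have r0 : 0 < r.
  rewrite lt_neqAle modz_ge0 // andbT eq_sym; apply: contra nda => /eqP r0.
  by apply/dvdz_mod0P.
have rd : r < d%:Z by exact: ltz_pmod.
apply/eqP => /(congr1 (@complex.Re R)) /=.
pose t : R := pi * r%:~R / d%:R.
have -> : 2 * pi * r%:~R / d%:R = t *+ 2 by rewrite /t -!mulrA mulr_natl.
rewrite cos_mulr2n cos2sin2 => c1.
have st : sin t = 0 by apply/eqP; rewrite -sqrf_eq0; apply/eqP; lra.
have : 0 < sin t; last by rewrite st ltxx.
apply: sin_gt0_pi; rewrite /t divr_gt0 ?mulr_gt0 ?pi_gt0 ?ltr0z ?ltr0n //=.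
rewrite ltr_pdivrMr ?ltr0n // ltr_pM2l ?pi_gt0 //.
by rewrite -[d%:R]/((d%:Z)%:~R) ltr_int.
Qed.

Lemma chi_ortho (z : int) :
  \sum_(p < d) chi (p%:Z * z) = if (d%:Z %| z)%Z then d%:R else 0.
Proof.
under eq_bigr do rewrite chiMn.
case: ifPn => [/chi_period ->|/chi_neq1 z1].
  by under eq_bigr do rewrite expr1n; rewrite sumr_const card_ord.
have := subrX1 (chi z) d.
rewrite -chiMn chi_period ?dvdz_mulr // subrr => /esym/eqP.
by rewrite mulf_eq0 subr_eq0 (negbTE z1) => /eqP.
Qed.

Lemma dvdz_subC (a b : int) : (d%:Z %| a - b)%Z = (d%:Z %| b - a)%Z.
Proof. by rewrite -[RHS]rpredN opprB. Qed.

Lemma dvdz_addl (a b : int) : (d%:Z %| a)%Z -> (d%:Z %| a + b)%Z = (d%:Z %| b)%Z.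
Proof. exact: rpredDl. Qed.

Lemma dvdz_addr (a b : int) : (d%:Z %| b)%Z -> (d%:Z %| a + b)%Z = (d%:Z %| a)%Z.
Proof. exact: rpredDr. Qed.

Definition residue (z : int) : 'I_d := inord `|(z %% d%:Z)%Z|.

Lemma residueE z : (residue z)%:Z = (z %% d%:Z)%Z.
Proof.
rewrite /residue inordK ?gez0_abs ?modz_ge0 //.
by rewrite -ltz_nat gez0_abs ?modz_ge0 // ltz_pmod.
Qed.

Lemma dvdz_residue z (l : 'I_d) : (d%:Z %| z - l%:Z)%Z = (l == residue z).
Proof.
rewrite -eqz_mod_dvd -(inj_eq val_inj) /= -eqz_nat residueE eq_sym.
by rewrite (modz_small (m := l%:Z)) // ltz_nat ltn_ord.
Qed.

(** Evaluates the intermediate sum in a product of Weyl operators, where the shift leaves a single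
    index. *)
Lemma sum_residue z (F : 'I_d -> C) :
  \sum_(l < d) (if (d%:Z %| z - l%:Z)%Z then F l else 0) = F (residue z).
Proof.
under eq_bigr do rewrite dvdz_residue.
by rewrite -big_mkcond /= big_pred1_eq.
Qed.

Lemma mul_ifl (b : bool) (x y : C) :
  (if b then x else 0) * y = if b then x * y else 0.
Proof. by case: b; rewrite ?mul0r. Qed.

Lemma mul_ifr (b : bool) (x y : C) :
  x * (if b then y else 0) = if b then x * y else 0.
Proof. by case: b; rewrite ?mulr0. Qed.

(* The matrix entry <a| w(p, q) |b> of a single-qudit Weyl operator. *)
Definition site (p q a b : int) : C :=
  if (d%:Z %| a - b - q)%Z then chi (- (h * p * q) + p * a) else 0.

Lemma weylE n (p q : 'I_n -> int) k k' : weyl R d p q k' k =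
  \prod_(j < n) site (p j) (q j) (digit d j k')%:Z (digit d j k)%:Z.
Proof.
rewrite mxE; case: forallP => [H|H].
  apply: eq_bigr => j _; rewrite /site.
  by have /dvdz_mod0P -> := eqP (H j).
apply/esym/eqP; apply/prodf_eq0; move/forallP: H; rewrite negb_forall.
case/existsP => j nj; exists j => //; rewrite /site ifN //.
by apply: contra nj => /dvdz_mod0P ->.
Qed.

(** For odd d, [h] inverts 2 and the phase is half the symplectic form, h (p q' - p' q) modulo d.
    The two exponents agree only modulo d, as the intermediate index is a reduced residue. *)
Lemma site_mul p q p' q' a b :
  \sum_(l < d) site p q a l%:Z * site p' q' l%:Z b =
  chi (h * (p * q' + p' * q) - p' * q) * site (p + p') (q + q') a b.
Proof.
rewrite /site.
under eq_bigr => l _ do rewrite (addrAC a) mul_ifl.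
rewrite sum_residue mul_ifr residueE.
set l := (_ %% _)%Z; pose D := d%:Z.
have lE : (D %| a - q - l)%Z by rewrite {1}(divz_eq (a - q) D) addrK dvdz_mull.
have -> : (D %| l - b - q')%Z = (D %| a - b - (q + q'))%Z.
  rewrite (_ : a - b - (q + q') = (a - q - l) + (l - b - q')); last by ring.
  by rewrite (dvdz_addl _ lE).
rewrite mul_ifr; case: ifP => // _; rewrite -!chiD; apply: chi_congr.
set e := (X in (_ %| X)%Z).
have -> : e = - p' * (a - q - l) by rewrite /e; ring.
exact: dvdz_mull.
Qed.

Lemma site_unitary p q a b :
  \sum_(l < d) site p q a l%:Z * Num.conj (site p q b l%:Z) =
  (d%:Z %| a - b)%Z%:R.
Proof.
rewrite /site.
under eq_bigr => l _ do rewrite (addrAC a) mul_ifl.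
rewrite sum_residue residueE; set l := (_ %% _)%Z; pose D := d%:Z.
have lE : (D %| a - q - l)%Z by rewrite {1}(divz_eq (a - q) D) addrK dvdz_mull.
have -> : (D %| b - l - q)%Z = (D %| a - b)%Z.
  rewrite [RHS]dvdz_subC (_ : b - a = (b - l - q) + - (a - q - l)); last by ring.
  by rewrite dvdz_addr // rpredN; exact: lE.
case: ifP => [ab|_]; last by rewrite rmorph0 mulr0.
rewrite conj_chi -chiD; apply: chi_period.
set e := (X in (_ %| X)%Z).
have -> : e = p * (a - b) by rewrite /e; ring.
exact: dvdz_mull.
Qed.

Lemma site_congr p q p' q' a b : (d%:Z %| p - p')%Z -> (d%:Z %| q - q')%Z ->
  site p q a b = site p' q' a b.
Proof.
move=> pp qq; rewrite /site; congr (if _ then _ else _).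
  rewrite (_ : a - b - q' = (a - b - q) + (q - q')); last by ring.
  by rewrite (dvdz_addr _ qq).
apply: chi_congr; set e := (X in (_ %| X)%Z).
have -> : e = (a - h * q) * (p - p') - h * p' * (q - q') by rewrite /e; ring.
by rewrite rpredB // dvdz_mull.
Qed.

Lemma dvdz_sub_ord (a b : 'I_d) : (d%:Z %| a%:Z - b%:Z)%Z = (a == b).
Proof.
by rewrite -eqz_mod_dvd !modz_small ?ltz_nat ?ltn_ord.
Qed.

Lemma site_complete (a b k' k : 'I_d) : odd d ->
  \sum_(p < d) \sum_(q < d)
    site (- p%:Z) (- q%:Z) b%:Z a%:Z * site p%:Z q%:Z k'%:Z k%:Z =
  ((k' == a) && (k == b))%:R * d%:R.
Proof.
move=> od; rewrite exchange_big /=.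
(* Where oddness enters: since 2 h = 1 modulo d, the quadratic phases of w(-p, -q) and w(p, q)
   combine with k' = k + q into p (k - b), a character in p that can be summed. *)
have h2 : h * 2 = d%:Z + 1.
  by rewrite -[2]/(2%:Z) -PoszM muln2 halfK oddS od subn0 -addn1 PoszD.
have E (q p : 'I_d) :
    site (- p%:Z) (- q%:Z) b%:Z a%:Z * site p%:Z q%:Z k'%:Z k%:Z =
    if (d%:Z %| (a%:Z - b%:Z) - q%:Z)%Z then
      if (d%:Z %| k'%:Z - k%:Z - q%:Z)%Z then chi (p%:Z * (k%:Z - b%:Z)) else 0
    else 0.
  rewrite /site mul_ifl mul_ifr.
  rewrite (_ : b%:Z - a%:Z - - q%:Z = - ((a%:Z - b%:Z) - q%:Z)); last by ring.
  rewrite rpredN; case: ifP => // _; case: ifP => // kq.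
  rewrite -chiD; apply: chi_congr; set e := (X in (_ %| X)%Z).
  have -> : e = p%:Z * (k'%:Z - k%:Z - q%:Z) - (h * 2 - 1) * (p%:Z * q%:Z).
    by rewrite /e; ring.
  rewrite h2 addrK; apply: rpredB; [exact: dvdz_mull|exact: dvdz_mulr].
have {}E (q : 'I_d) : \sum_(p < d)
    site (- p%:Z) (- q%:Z) b%:Z a%:Z * site p%:Z q%:Z k'%:Z k%:Z =
    if (d%:Z %| (a%:Z - b%:Z) - q%:Z)%Z then
      if (d%:Z %| k'%:Z - k%:Z - q%:Z)%Z then (k == b)%:R * d%:R else 0
    else 0.
  under eq_bigr do rewrite E.
  case: ifP => _; last by rewrite big1.
  case: ifP => _; last by rewrite big1.
  by rewrite chi_ortho dvdz_sub_ord; case: eqP => _; rewrite ?mul1r ?mul0r.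
under eq_bigr do rewrite E.
rewrite sum_residue residueE; set l := (_ %% _)%Z; pose D := d%:Z.
have lE : (D %| a%:Z - b%:Z - l)%Z.
  by rewrite {1}(divz_eq (a%:Z - b%:Z) D) addrK dvdz_mull.
have [->|kb] := eqVneq k b; last by rewrite andbF mul0r; case: ifP.
rewrite (_ : k'%:Z - b%:Z - l = (k'%:Z - a%:Z) + (a%:Z - b%:Z - l)); last by ring.
rewrite (dvdz_addr _ lE) dvdz_sub_ord andbT mul1r.
by case: eqP => _; rewrite ?mul1r ?mul0r.
Qed.

End Weyl.

(** * Weyl operators on n qudits *)

Section WeylGroup.
Variable R : realType.
Local Notation C := (R[i]).
Variables d' n : nat.
Local Notation d := d'.+1.
Local Notation chi := (chi R d).
Local Notation h := (d.+1./2%:Z).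
Local Notation digs := {ffun 'I_n -> 'I_d}.
Local Notation V := (digs * digs)%type.

Definition digits (k : 'I_(d ^ n)) : digs := [ffun j : 'I_n => inord (digit d j k)].

Lemma digitsE k j : digits k j = digit d j k :> nat.
Proof. by rewrite ffunE inordK // ltn_mod. Qed.

Lemma digit_inj m k l : (k < d ^ m)%N -> (l < d ^ m)%N ->
  (forall j, (j < m)%N -> digit d j k = digit d j l) -> k = l.
Proof.
elim: m k l => [|m IH] k l; first by rewrite expn0 !ltnS !leqn0 => /eqP -> /eqP ->.
rewrite expnS => km lm H; rewrite (divn_eq k d) (divn_eq l d).
have -> : (k %% d = l %% d)%N by have := H 0%N isT; rewrite /digit expn0 !divn1.
congr (_ * _ + _)%N; apply: IH => [||j jm]; try by rewrite ltn_divLR // mulnC.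
by have := H j.+1 jm; rewrite /digit expnS !divnMA.
Qed.

Lemma digits_inj : injective digits.
Proof.
move=> k l kl; apply/val_inj; apply: (@digit_inj n); rewrite ?ltn_ord // => j jn.
by have /ffunP/(_ (Ordinal jn))/(congr1 val) := kl; rewrite /= !digitsE.
Qed.

Lemma digits_bij : bijective digits.
Proof. by apply: inj_card_bij digits_inj _; rewrite card_ffun !card_ord. Qed.

(** Reduces sums over basis indices, such as those in matrix products, to one qudit at a time. *)
Lemma sum_digits (F : 'I_n -> 'I_d -> C) :
  \sum_k \prod_j F j (digits k j) = \prod_j \sum_a F j a.
Proof.
by rewrite bigA_distr_bigA /= (reindex digits) //; exact: onW_bij digits_bij.
Qed.

Lemma prod_eqffun (f g : digs) : \prod_j (f j == g j)%:R = (f == g)%:R :> C.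
Proof.
have [->|fg] := eqVneq f g; first by rewrite big1 // => j _; rewrite eqxx.
apply/eqP; rewrite prodf_seq_eq0; apply/hasP.
have /existsP[j fj] : [exists j, f j != g j].
  rewrite -negb_forall; apply: contra fg => /forallP fg.
  by apply/eqP/ffunP => j; apply/eqP/fg.
by exists j; rewrite ?mem_index_enum //= (negbTE fj).
Qed.

Lemma weyl_site (p q : 'I_n -> int) k' k : weyl R d p q k' k =
  \prod_j site R d' (p j) (q j) (digits k' j)%:Z (digits k j)%:Z.
Proof. by rewrite weylE; apply: eq_bigr => j _; rewrite !digitsE. Qed.

Lemma weyl_mul (p q p' q' : 'I_n -> int) :
  weyl R d p q *m weyl R d p' q' =
  chi (\sum_j (h * (p j * q' j + p' j * q j) - p' j * q j)) *:
  weyl R d (fun j => p j + p' j) (fun j => q j + q' j).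
Proof.
apply/matrixP=> a b; rewrite mxE [RHS]mxE weyl_site chi_sum -big_split /=.
under eq_bigr do rewrite !weyl_site -big_split /=.
rewrite (sum_digits (fun j l => site R d' (p j) (q j) (digits a j)%:Z l%:Z *
  site R d' (p' j) (q' j) l%:Z (digits b j)%:Z)).
by apply: eq_bigr => j _; rewrite site_mul.
Qed.

Lemma weyl_unitary (p q : 'I_n -> int) : unitary (weyl R d p q).
Proof.
apply/matrixP=> a b; rewrite mxE [RHS]mxE.
under eq_bigr do rewrite adjE !weyl_site rmorph_prod -big_split /=.
rewrite (sum_digits (fun j l => site R d' (p j) (q j) (digits a j)%:Z l%:Z *
  Num.conj (site R d' (p j) (q j) (digits b j)%:Z l%:Z))).
under eq_bigr do rewrite site_unitary dvdz_sub_ord.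
by rewrite prod_eqffun (inj_eq digits_inj).
Qed.

Lemma weyl_congr (p q p' q' : 'I_n -> int) :
  (forall j, (d%:Z %| p j - p' j)%Z) -> (forall j, (d%:Z %| q j - q' j)%Z) ->
  weyl R d p q = weyl R d p' q'.
Proof.
move=> pp qq; apply/matrixP=> a b; rewrite !weyl_site.
by apply: eq_bigr => j _; apply: site_congr.
Qed.

Lemma weyl0 : weyl R d (fun=> 0) (fun=> 0) = 1%:M :> 'M[C]_(d ^ n).
Proof.
apply/matrixP=> a b; rewrite weyl_site mxE -(inj_eq digits_inj) -prod_eqffun.
apply: eq_bigr => j _; rewrite /site subr0 dvdz_sub_ord mulr0 mul0r oppr0 addr0.
by rewrite chi0; case: eqP.
Qed.

Definition weyl_at (x : V) : 'M[C]_(d ^ n) := weyl R d (toZ x.1) (toZ x.2).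
Definition weyl_opp_at (x : V) : 'M[C]_(d ^ n) :=
  weyl R d (fun j => - toZ x.1 j) (fun j => - toZ x.2 j).

Lemma weyl_complete a b k' k : odd d ->
  \sum_x weyl_opp_at x b a * weyl_at x k' k = ((k' == a) && (k == b))%:R * d%:R ^+ n.
Proof.
move=> od.
rewrite -(pair_bigA _
  (fun p q => weyl_opp_at (p, q) b a * weyl_at (p, q) k' k)) /=.
pose F j (p q : 'I_d) : C :=
  site R d' (- p%:Z) (- q%:Z) (digits b j)%:Z (digits a j)%:Z *
  site R d' p%:Z q%:Z (digits k' j)%:Z (digits k j)%:Z.
transitivity (\prod_j \sum_p \sum_q F j p q).
  rewrite bigA_distr_bigA; apply: eq_bigr => p _.
  rewrite bigA_distr_bigA; apply: eq_bigr => q _.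
  by rewrite /weyl_opp_at /weyl_at !weyl_site -big_split.
under eq_bigr do rewrite site_complete // -mulnb natrM.
rewrite !big_split /= !prod_eqffun !(inj_eq digits_inj) -natrM mulnb.
by rewrite prodr_const card_ord.
Qed.

Lemma weyl_expansion (rho : 'M[C]_(d ^ n)) : odd d ->
  rho = d%:R ^- n *: \sum_x \tr (rho *m weyl_opp_at x) *: weyl_at x.
Proof.
move=> od; apply/matrixP=> k' k; rewrite mxE summxE.
have dn0 : d%:R ^+ n != 0 :> C by rewrite expf_neq0 // pnatr_eq0.
apply: (mulfI dn0); rewrite mulrA mulfV // mul1r.
transitivity (\sum_x \sum_a \sum_b
    rho a b * (weyl_opp_at x b a * weyl_at x k' k)); last first.
  apply: eq_bigr => x _; rewrite [RHS]mxE mulr_suml; apply: eq_bigr => a _.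
  by rewrite [(rho *m _) a a]mxE mulr_suml; apply: eq_bigr => b _; rewrite mulrA.
rewrite exchange_big (bigD1 k') //= [X in _ + X]big1 ?addr0 => [|a ak].
  rewrite exchange_big (bigD1 k) //= [X in _ + X]big1 ?addr0 => [|b bk].
    by rewrite -mulr_sumr weyl_complete // !eqxx mul1r mulrC.
  by rewrite -mulr_sumr weyl_complete // (eq_sym k) (negbTE bk) andbF mul0r mulr0.
rewrite exchange_big big1 // => b _.
by rewrite -mulr_sumr weyl_complete // (eq_sym k') (negbTE ak) mul0r mulr0.
Qed.

(** The symplectic form on integer representatives. It is additive only modulo d, since addition in
    [V] wraps around; [chi] does not see the difference. *)
Definition omega (y x : V) : int :=
  \sum_j (toZ y.1 j * toZ x.2 j - toZ x.1 j * toZ y.2 j).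

(** The [h] parts of the two product phases are symmetric in x and y and cancel, leaving the
    symplectic form. *)
Lemma weyl_commute y x :
  weyl_at y *m weyl_at x *m adj (weyl_at y) = chi (omega y x) *: weyl_at x.
Proof.
suff -> : weyl_at y *m weyl_at x = chi (omega y x) *: (weyl_at x *m weyl_at y).
  by rewrite -scalemxAl -mulmxA weyl_unitary mulmx1.
rewrite /weyl_at !weyl_mul scalerA -chiD; congr (chi _ *: _); last first.
  by apply: weyl_congr => j; rewrite [X in _ - X]addrC subrr.
by rewrite /omega -big_split /=; apply: eq_bigr => j _; ring.
Qed.

Lemma toZD (p q : digs) j : (d%:Z %| toZ (p + q) j - (toZ p j + toZ q j))%Z.
Proof.
rewrite /toZ ffunE /= -eqz_mod_dvd -PoszD !modz_nat modn_mod.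
exact: eqxx.
Qed.

Lemma omegaD y x x0 : chi (omega y (x + x0)) = chi (omega y x) * chi (omega y x0).
Proof.
rewrite -chiD; apply: chi_congr; rewrite /omega -big_split /= -sumrB.
apply: rpred_sum => j _; set e := (X in X \in _).
have -> : e = toZ y.1 j * (toZ (x.2 + x0.2) j - (toZ x.2 j + toZ x0.2 j))
   - toZ y.2 j * (toZ (x.1 + x0.1) j - (toZ x.1 j + toZ x0.1 j)).
  by rewrite /e /=; ring.
by apply: rpredB; apply: dvdz_mull; exact: toZD.
Qed.

Lemma weyl_opp_atM x x0 : exists2 c : C, `|c| = 1 &
  weyl_opp_at x *m weyl_opp_at x0 = c *: weyl_opp_at (x + x0).
Proof.
rewrite /weyl_opp_at weyl_mul.
set c := chi _; exists c; first exact: norm_chi.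
congr (_ *: _); apply: weyl_congr => j; rewrite -opprD opprK addrC;
  exact: toZD.
Qed.

(** Nondegeneracy of the symplectic form: the sum splits into 2n one-digit character sums, the p
    digits of y testing the q part of x - x' and the q digits its p part. *)
Lemma omega_ortho (x x' : V) : \sum_y chi (omega y x - omega y x') =
  (x == x')%:R * (d%:R ^+ n * d%:R ^+ n).
Proof.
pose u j := toZ x.2 j - toZ x'.2 j; pose v j := toZ x'.1 j - toZ x.1 j.
transitivity (\sum_(p : digs) \sum_(q : digs)
   (\prod_j chi ((p j)%:Z * u j)) * (\prod_j chi ((q j)%:Z * v j))).
  rewrite pair_bigA; apply: eq_bigr => -[p q] _ /=.
  rewrite -!chi_sum -chiD /omega -sumrB -big_split /=; congr chi.
  by apply: eq_bigr => j _; rewrite /u /v /toZ /=; ring.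
under eq_bigr do rewrite -mulr_sumr.
rewrite -mulr_suml.
rewrite -(bigA_distr_bigA (fun j (a : 'I_d) => chi (a%:Z * u j))).
rewrite -(bigA_distr_bigA (fun j (a : 'I_d) => chi (a%:Z * v j))).
have E (f g : digs) (z : 'I_n -> int) :
    (forall j, (d%:Z %| z j)%Z = (f j == g j)) ->
    \prod_j (\sum_(a < d) chi (a%:Z * z j)) = (f == g)%:R * d%:R ^+ n.
  move=> fg; rewrite -prod_eqffun -[X in _ * _ ^+ X]card_ord -prodr_const -big_split.
  apply: eq_bigr => j _; rewrite /= chi_ortho fg.
  by case: eqP; rewrite ?mul1r ?mul0r.
rewrite (E x.2 x'.2) => [|j]; last exact: dvdz_sub_ord.
rewrite (E x'.1 x.1) => [|j]; last exact: dvdz_sub_ord.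
rewrite mulrACA -natrM mulnb (eq_sym x'.1) andbC.
by case: x x' @u @v => [p q] [p' q'] _ _.
Qed.

(** Equality case of Cauchy-Schwarz. With rho = T^* T, the squared Hilbert-Schmidt norm of T (w - c)
    is Tr rho (w - c)(w - c)^* = 2 - 2 |c|^2 = 0. *)
Lemma norm1_stabilizes m (rho w : 'M[C]_m) : is_state rho -> unitary w ->
  `|\tr (rho *m w)| = 1 -> rho *m w = \tr (rho *m w) *: rho.
Proof.
move=> [pr tr1] wu; set c := \tr _ => c1.
have [T rE] := psd_factor pr.
have cc : c * Num.conj c = 1 by rewrite -normCK c1 expr1n.
have twa : \tr (rho *m adj w) = Num.conj c.
  have -> : rho *m adj w = adj (w *m rho) by rewrite adjM (psd_adj pr).
  rewrite /c mxtrace_mulC /mxtrace rmorph_sum; apply: eq_bigr => i _.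
  by rewrite !mxE.
have K0 : T *m (w - c%:M) = 0.
  apply: mxtrace_adjM_eq0; rewrite adjM mulmxA -(mulmxA _ (adj T)) -rE.
  rewrite -mulmxA mxtrace_mulC -mulmxA.
  have -> : (w - c%:M) *m adj (w - c%:M) = 2%:M - (Num.conj c *: w + c *: adj w).
    have -> : adj (w - c%:M) = adj w - (Num.conj c)%:M.
      by apply/matrixP=> i j; rewrite !mxE rmorphB rmorphMn /= eq_sym.
    rewrite mulmxBl !mulmxBr wu mul_mx_scalar !mul_scalar_mx scale_scalar_mx cc.
    have -> : 2%:M = 1%:M + 1%:M :> 'M[C]_m by rewrite -raddfD.
    by rewrite opprB addrACA opprD.
  rewrite mulmxBr mulmxDr -!scalemxAr mul_mx_scalar raddfB raddfD /= !mxtraceZ.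
  by rewrite twa -/c tr1 mulr1 [_ * c]mulrC cc subrr.
apply/eqP; rewrite -subr_eq0 -mul_mx_scalar -mulmxBr rE -mulmxA K0.
by rewrite mulmx0.
Qed.

Lemma norm1_mxtraceM m (rho A B : 'M[C]_m) : is_state rho -> unitary A ->
  `|\tr (rho *m A)| = 1 -> `|\tr (rho *m B)| = 1 -> `|\tr (rho *m (A *m B))| = 1.
Proof.
move=> sr uA c1 c0; rewrite mulmxA (norm1_stabilizes sr uA c1).
by rewrite -scalemxAl mxtraceZ normrM c1 c0 mulr1.
Qed.

(** * The mean state as a Weyl twirl *)

Section MeanState.
Variable rho : 'M[C]_(d ^ n).
Hypotheses (d_odd : odd d) (rho_state : is_state rho).

Definition stabilizes (x : V) : bool := `|\tr (rho *m weyl_opp_at x)| == 1.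

Lemma stabilizesD x x0 : stabilizes x -> stabilizes x0 -> stabilizes (x + x0).
Proof.
move=> /eqP c1 /eqP c0; have [c cn cE] := weyl_opp_atM x x0.
apply/eqP; rewrite -[LHS]mul1r -cn -normrM -mxtraceZ scalemxAr -cE.
have ux : unitary (weyl_opp_at x) := weyl_unitary _ _.
by rewrite (norm1_mxtraceM rho_state ux c1 c0).
Qed.

Lemma stabilizes0 : stabilizes 0.
Proof.
have weyl_opp0 : weyl_opp_at 0 = 1%:M.
  by rewrite /weyl_opp_at -weyl0; apply: weyl_congr => j; rewrite /toZ ffunE oppr0 subr0.
rewrite /stabilizes weyl_opp0 mulmx1; by case: rho_state => _ ->; rewrite normr1.
Qed.

(** A character sum over a group: translation by x0 multiplies it by the value at x0, so it vanishes
    unless the character is trivial, and then every term is 1. *)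
Lemma chi_omega_sum_ge0 y : 0 <= \sum_(x | stabilizes x) chi (- omega y x).
Proof.
set S := \sum_(_ | _) _.
have inv x0 : stabilizes x0 -> S = chi (- omega y x0) * S.
  move=> sx0; rewrite mulr_sumr.
  pose G := [set x | stabilizes x].
  (* Translation maps [G] into itself injectively, hence onto by finiteness. *)
  have GE : (fun x : V => x + x0) @: G = G.
    apply/eqP; rewrite eqEcard card_imset ?leqnn ?andbT; last exact: addIr.
    by apply/fintype.subsetP => _ /imsetP[x + ->]; rewrite !inE => sx; exact: stabilizesD.
  have SG F : \sum_(x | stabilizes x) F x = \sum_(x in G) F x :> C.
    by apply: eq_bigl => x; rewrite inE.
  rewrite /S !SG -{1}GE big_imset /=; last by move=> ? ? _ _; exact: addIr.
  apply: eq_bigr => x _.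
  by rewrite -!conj_chi omegaD rmorphM mulrC.
have [/forallP triv|] := boolP [forall x, stabilizes x ==> (chi (- omega y x) == 1)].
  rewrite /S; apply: sumr_ge0 => x sx.
  by have /implyP/(_ sx)/eqP -> := triv x; exact: ler01.
rewrite negb_forall => /existsP[x0]; rewrite negb_imply => /andP[/inv SE c1].
suff -> : S = 0 by [].
apply/eqP; move/eqP: SE; rewrite -{1}[S]mul1r -subr_eq0 -mulrBl mulf_eq0.
by rewrite subr_eq0 eq_sym (negbTE c1).
Qed.

(* Weights of the Weyl twirl realizing the mean state: the Fourier transform of
   the indicator of the stabilizer group, which up to normalization is the
   indicator of its symplectic complement. *)
Definition twirl_weight (y : V) : C :=
  (d%:R ^+ n * d%:R ^+ n)^-1 * \sum_(x | stabilizes x) chi (- omega y x).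

Lemma twirl_weight_fourier x :
  \sum_y twirl_weight y * chi (omega y x) = (stabilizes x)%:R.
Proof.
have N0 : d%:R ^+ n * d%:R ^+ n != 0 :> C by rewrite mulf_neq0 // expf_neq0 // pnatr_eq0.
transitivity ((d%:R ^+ n * d%:R ^+ n)^-1 *
    \sum_(x' | stabilizes x') \sum_y chi (omega y x - omega y x')).
  rewrite exchange_big mulr_sumr; apply: eq_bigr => y _.
  rewrite /twirl_weight -mulrA mulr_suml; congr (_ * _).
  by apply: eq_bigr => x' _; rewrite chiD mulrC.
under eq_bigr do rewrite omega_ortho.
rewrite -mulr_suml mulrCA mulVf // mulr1.
have [sx|sx] := boolP (stabilizes x).
  rewrite (bigD1 x) //= eqxx big1 ?addr0 // => x' /andP[_ xx'].
  by rewrite eq_sym (negbTE xx').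
by rewrite big1 // => x' sx'; case: eqP => // xx'; rewrite xx' sx' in sx.
Qed.

Lemma mean_state_twirl : exists mu : V -> R,
  [/\ forall y, 0 <= mu y, \sum_y mu y = 1 &
   mean_state rho = \sum_y realC (mu y) *: (weyl_at y *m rho *m adj (weyl_at y))].
Proof.
have mu0 y : 0 <= twirl_weight y.
  by rewrite mulr_ge0 ?chi_omega_sum_ge0 // invr_ge0 mulr_ge0 // exprn_ge0 // ler0n.
have muE y : realC (complex.Re (twirl_weight y)) = twirl_weight y.
  by rewrite realCE RRe_real // realE mu0.
exists (fun y => complex.Re (twirl_weight y)); split=> [y||].
- by rewrite -ler0c -realCE muE.
(* The total mass is the Fourier coefficient at x = 0, and 0 lies in the stabilizer because Tr rho =
   1. *)
- apply: (@complexI R); rewrite -!realCE realC_sum.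
  have := twirl_weight_fourier 0; rewrite stabilizes0 => fourier0.
  rewrite [RHS](_ : _ = true%:R) // -fourier0.
  apply: eq_bigr => y _; rewrite muE /omega big1 ?chi0 ?mulr1 // => j _.
  by rewrite /toZ !ffunE mulr0 mul0r subr0.
under eq_bigr do rewrite muE.
transitivity (d%:R ^- n *:
    \sum_x (stabilizes x)%:R *: (\tr (rho *m weyl_opp_at x) *: weyl_at x)).
  rewrite /mean_state pair_bigA; congr (_ *: _); apply: eq_bigr => x _ /=.
  rewrite /stabilizes /charfun -/(weyl_opp_at x) -/(weyl_at x).
  by case: ifP => _; rewrite ?scale1r ?scale0r.
have E y : weyl_at y *m rho *m adj (weyl_at y) = d%:R ^- n *:
    \sum_x chi (omega y x) *: (\tr (rho *m weyl_opp_at x) *: weyl_at x).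
  rewrite {1}(weyl_expansion rho d_odd) -scalemxAr -scalemxAl; congr (_ *: _).
  rewrite mulmx_sumr mulmx_suml; apply: eq_bigr => x _.
  by rewrite -scalemxAr -scalemxAl weyl_commute !scalerA mulrC.
under [RHS]eq_bigr do rewrite E scalerA mulrC -scalerA scaler_sumr.
rewrite -scaler_sumr exchange_big; congr (_ *: _); apply: eq_bigr => x _ /=.
rewrite -twirl_weight_fourier scaler_suml; apply: eq_bigr => y _.
by rewrite [RHS]scalerA.
Qed.

End MeanState.

End WeylGroup.

(** * Mean channels *)

Section Blocks.
Variable R : realType.
Local Notation C := (R[i]).

Lemma sum_mxtens m n (F : 'I_(m * n) -> C) :
  \sum_r F r = \sum_i \sum_j F (mxtens_index (i, j)).
Proof.
rewrite pair_bigA (reindex (@mxtens_index m n)); first by apply: eq_bigr => -[].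
by exists (@mxtens_unindex m n) => r _; rewrite ?mxtens_indexK ?mxtens_unindexK.
Qed.

Lemma adj_tens m n p q (A : 'M[C]_(m, n)) (B : 'M[C]_(p, q)) :
  adj (A *t B) = adj A *t adj B.
Proof. by rewrite /adj trmx_tens map_mxT. Qed.

Lemma unitary_tens m n (A : 'M[C]_m) (B : 'M[C]_n) :
  unitary A -> unitary B -> unitary (A *t B).
Proof.
move=> uA uB; rewrite /unitary adj_tens tensmx_mul uA uB.
apply/matrixP=> r c; case: (mxtens_indexP r) => i a; case: (mxtens_indexP c) => j b.
rewrite tensmxE !mxE (inj_eq (can_inj (@mxtens_indexK m n))) xpair_eqE.
by rewrite -natrM mulnb.
Qed.

(** The block of X at ancilla indices (a, b). [tens_id L] is L on each block, so identities between
    such extensions are checked blockwise. *)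
Definition ancilla_block N m (X : 'M[C]_(N * m)) (a b : 'I_m) : 'M[C]_N :=
  \matrix_(i, j) X (mxtens_index (i, a)) (mxtens_index (j, b)).

Lemma ancilla_block_inj N m (X Y : 'M[C]_(N * m)) :
  (forall a b, ancilla_block X a b = ancilla_block Y a b) -> X = Y.
Proof.
move=> XY; apply/matrixP=> r c.
case: (mxtens_indexP r) => i a; case: (mxtens_indexP c) => j b.
by have /matrixP/(_ i j) := XY a b; rewrite !mxE.
Qed.

Lemma ancilla_block_tens_id N m L (X : 'M[C]_(N * m)) a b :
  ancilla_block (tens_id L X) a b = L (ancilla_block X a b).
Proof. by apply/matrixP=> i j; rewrite !mxE !mxtens_indexK. Qed.

Lemma ancilla_block_sum N m (I : finType) (c : I -> C) (X : I -> 'M[C]_(N * m)) a b :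
  ancilla_block (\sum_i c i *: X i) a b = \sum_i c i *: ancilla_block (X i) a b.
Proof.
apply/matrixP=> i j; rewrite mxE !summxE.
by apply: eq_bigr => k _; rewrite !mxE.
Qed.

Lemma ancilla_block_conj N m (X : 'M[C]_(N * m)) (A : 'M[C]_N) a b :
  ancilla_block (A *t 1%:M *m X *m adj (A *t 1%:M)) a b =
  A *m ancilla_block X a b *m adj A.
Proof.
apply/matrixP=> i j; rewrite [LHS]mxE [LHS]mxE [RHS]mxE sum_mxtens.
apply: eq_bigr => k _; rewrite (bigD1 b) //= big1 ?addr0 => [|c cb].
  rewrite adj_tens adj1 tensmxE [_%:M _ _]mxE eqxx mulr1; congr (_ * _).
  rewrite mxE [RHS]mxE sum_mxtens; apply: eq_bigr => l _.
  rewrite (bigD1 a) //= big1 ?addr0 => [|c ca].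
    by rewrite tensmxE [_%:M _ _]mxE eqxx mulr1 mxE.
  by rewrite tensmxE [_%:M _ _]mxE eq_sym (negbTE ca) mulr0 mul0r.
by rewrite adj_tens adj1 tensmxE [_%:M _ _]mxE (negbTE cb) mulr0 mulr0.
Qed.

Lemma mxtrace_ancilla_block N m (X : 'M[C]_(N * m)) :
  \tr X = \sum_a \tr (ancilla_block X a a).
Proof.
rewrite /mxtrace sum_mxtens exchange_big; apply: eq_bigr => a _.
by apply: eq_bigr => i _; rewrite mxE.
Qed.

Lemma psd_reindex m n (f : 'I_n -> 'I_m) (A : 'M[C]_m) :
  psd A -> psd (\matrix_(r, c) A (f r) (f c)).
Proof.
move=> pA; pose B : 'M[C]_(n, m) := \matrix_(r, k) (f r == k)%:R.
suff <- : B *m A *m adj B = \matrix_(r, c) A (f r) (f c) by exact: psd_conj.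
apply/matrixP=> r c; rewrite [LHS]mxE [RHS]mxE (bigD1 (f c)) //= big1 ?addr0.
  rewrite adjE [B c _]mxE eqxx rmorph1 mulr1 mxE (bigD1 (f r)) //= big1 ?addr0.
    by rewrite mxE eqxx mul1r.
  by move=> k kr; rewrite mxE eq_sym (negbTE kr) mul0r.
by move=> k kr; rewrite adjE [B c _]mxE eq_sym (negbTE kr) rmorph0 mulr0.
Qed.

(** Through the Kraus form of the replacer, the average 1/N of E_ik X E_ik^* over all matrix
    units. *)
Lemma psd_replacer N m (rho : 'M[C]_(N * m)) :
  psd rho -> psd (tens_id (@replacer R N) rho).
Proof.
move=> pr; pose K (ik : 'I_N * 'I_N) := delta_mx ik.1 ik.2 *t (1%:M : 'M[C]_m).
have -> : tens_id (@replacer R N) rho =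
    \sum_ik realC (N%:R^-1) *: (K ik *m rho *m adj (K ik)).
  apply: ancilla_block_inj => a b; rewrite ancilla_block_tens_id ancilla_block_sum.
  under eq_bigr do rewrite ancilla_block_conj.
  move: (ancilla_block rho a b) => X; rewrite -scaler_sumr /replacer.
  rewrite realCE fmorphV rmorph_nat mulrC -scalerA; congr (_ *: _).
  rewrite -(pair_bigA _ (fun i k => delta_mx i k *m X *m adj (delta_mx i k))) /=.
  have E i k : delta_mx i k *m X *m adj (delta_mx i k) = X k k *: delta_mx i i.
    apply/matrixP=> r c; rewrite [LHS]mxE (bigD1 k) //= big1 ?addr0 => [|j jk].
      rewrite adjE mxE (bigD1 k) //= big1 ?addr0 => [|j jk].
        rewrite !mxE !eqxx !andbT rmorph_nat; case: (r == i); case: (c == i);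
        by rewrite ?mulr1 ?mulr0 ?mul1r ?mul0r.
      by rewrite mxE (negbTE jk) andbF mul0r.
    by rewrite adjE [delta_mx _ _ c j]mxE (negbTE jk) andbF rmorph0 mulr0.
  under eq_bigr do (under eq_bigr do rewrite E; rewrite -scaler_suml).
  rewrite -scaler_sumr; congr (_ *: _).
  by apply/matrixP=> i j; rewrite mx1_sum_delta.
apply: psd_sum => [_|ik]; last exact: psd_conj.
by rewrite invr_ge0 ler0n.
Qed.

End Blocks.

(** * Linearity of channels and their Choi states *)

Section ChannelBasics.
Variable R : realType.
Local Notation C := (R[i]).
Variables (N : nat) (L : 'M[C]_N -> 'M[C]_N).
Hypothesis chL : is_channel N L.

Lemma channel0 : L 0 = 0.
Proof.
have [lin _ _] := chL; have := lin 1 0 0.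
by rewrite !scale1r addr0 -{1}[L 0]addr0 => /addrI.
Qed.

Lemma channelZ c X : L (c *: X) = c *: L X.
Proof. by have [lin _ _] := chL; have := lin c X 0; rewrite channel0 !addr0. Qed.

Lemma channel_sum (I : finType) (c : I -> C) (X : I -> 'M[C]_N) :
  L (\sum_i c i *: X i) = \sum_i c i *: L (X i).
Proof.
have [lin _ _] := chL.
apply: (big_rec2 (fun x y => L x = y)); first exact: channel0.
by move=> i y x _ <-; rewrite lin.
Qed.

Lemma channel_state m (rho : 'M[C]_(N * m)) : is_state rho -> is_state (tens_id L rho).
Proof.
have [_ trL pL] := chL; move=> [pr tr1]; split; first exact: pL.
rewrite mxtrace_ancilla_block -tr1 [RHS]mxtrace_ancilla_block.
by apply: eq_bigr => a _; rewrite ancilla_block_tens_id trL.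
Qed.

(* [choi] lists the reference system first, [tens_id] the output first, hence
   the swap of the two tensor factors. *)
Lemma choi_state : (0 < N)%N -> is_state (choi L).
Proof.
move=> N0; have NC0 : N%:R != 0 :> C by rewrite pnatr_eq0 -lt0n.
have [_ trL pL] := chL.
(* The maximally entangled state, whose blocks are the matrix units divided by N. *)
pose Phi : 'M[C]_(N * N) := \matrix_(r, c)
   (((mxtens_unindex r).1 == (mxtens_unindex r).2)%:R *
    ((mxtens_unindex c).1 == (mxtens_unindex c).2)%:R / N%:R).
have blockPhi a b : ancilla_block Phi a b = N%:R^-1 *: delta_mx a b.
  apply/matrixP=> i j; rewrite !mxE !mxtens_indexK /=.
  by case: (i == a); case: (j == b); rewrite ?mul1r ?mul0r ?mulr1 ?mulr0.
have pPhi : psd Phi.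
  pose u : 'M[C]_(N * N, 1) := \matrix_(r, _)
     ((mxtens_unindex r).1 == (mxtens_unindex r).2)%:R.
  have -> : Phi = u *m (N%:R^-1)%:M *m adj u.
    apply/matrixP=> r c; rewrite mul_mx_scalar [RHS]mxE big_ord1 !mxE rmorph_nat.
    by rewrite mulrC mulrA.
  apply: psd_conj => v; rewrite mul_mx_scalar -scalemxAl mxE mulr_ge0 ?invr_ge0 ?ler0n //.
  by rewrite mxE big_ord1 adjE mulrC mul_conjC_ge0.
pose sw (r : 'I_(N * N)) :=
  mxtens_index ((mxtens_unindex r).2, (mxtens_unindex r).1).
split.
  have -> : choi L = \matrix_(r, c) tens_id L Phi (sw r) (sw c).
    apply/matrixP=> r c; case: (mxtens_indexP r) => a i; case: (mxtens_indexP c) => b j.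
    rewrite [RHS]mxE /sw !mxtens_indexK /=.
    have /matrixP/(_ i j) := ancilla_block_tens_id L Phi a b.
    rewrite [LHS]mxE => ->; rewrite blockPhi channelZ !mxE !mxtens_indexK //.
  by apply: psd_reindex; apply: pL.
rewrite /mxtrace sum_mxtens.
have E (a : 'I_N) : \sum_i choi L (mxtens_index (a, i)) (mxtens_index (a, i)) = N%:R^-1.
  transitivity (N%:R^-1 * \tr (L (delta_mx a a))).
    rewrite mulr_sumr; apply: eq_bigr => i _.
    by rewrite mxE !mxtens_indexK.
  rewrite trL /mxtrace (bigD1 a) //= big1 ?addr0 => [|i ia].
    by rewrite mxE eqxx mulr1.
  by rewrite mxE (negbTE ia).
by rewrite (eq_bigr _ (fun a _ => E a)) sumr_const card_ord -[LHS]mulr_natl mulfV.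
Qed.

End ChannelBasics.

(** * The mean channel as a mixture of rotated copies of L *)

Section MeanChannel.
Variable R : realType.
Local Notation C := (R[i]).

Lemma castmx_state a b (e : a = b) (X : 'M[C]_a) :
  is_state X -> is_state (castmx (e, e) X).
Proof. by case: b / e; rewrite castmx_id. Qed.

Lemma castmx_mixture a b (e : a = b) (I : finType) (c : I -> C)
    (U : I -> 'M[C]_a) (J : 'M[C]_b) :
  castmx (e, e) (\sum_i c i *: (U i *m castmx (esym e, esym e) J *m adj (U i))) =
  \sum_i c i *: (castmx (e, e) (U i) *m J *m adj (castmx (e, e) (U i))).
Proof.
case: b / e J => J; rewrite !castmx_id.
by apply: eq_bigr => i _; rewrite !castmx_id.
Qed.

Lemma digit_low d n j i l : (0 < d)%N -> (j < n)%N ->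
  digit d j (i * d ^ n + l) = digit d j l.
Proof.
move=> d0 jn; have dvd : (d %| i * d ^ (n - j))%N.
  by rewrite dvdn_mull // dvdn_exp // subn_gt0.
rewrite /digit -{1}(subnK (ltnW jn)) expnD mulnA divnMDl ?expn_gt0 ?d0 //.
by rewrite -modnDml (eqP dvd).
Qed.

Lemma digit_high d n j i l : (l < d ^ n)%N ->
  digit d (n + j) (i * d ^ n + l) = digit d j i.
Proof.
move=> ln; rewrite /digit expnD divnMA divnMDl ?(leq_ltn_trans _ ln) //.
by rewrite (divn_small ln) addn0.
Qed.

(** A pair (i, k) is encoded as i d^n + k, so the first tensor factor carries the high digits: the
    reference system takes the [rshift] labels and the output the [lshift] ones. *)
Lemma castmx_weyl d' n (p q : 'I_(n + n) -> int) :
  castmx (expnD d'.+1 n n, expnD d'.+1 n n) (weyl R d'.+1 p q) =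
  weyl R d'.+1 (p \o @rshift n n) (q \o @rshift n n) *t
  weyl R d'.+1 (p \o @lshift n n) (q \o @lshift n n).
Proof.
apply/matrixP=> r c; case: (mxtens_indexP r) => i k; case: (mxtens_indexP c) => j l.
rewrite castmxE tensmxE !weylE big_split_ord /= mulrC.
by congr (_ * _); apply: eq_bigr => s _; rewrite ?digit_high ?digit_low.
Qed.

Lemma unitary_tr m (A : 'M[C]_m) : unitary A -> unitary A^T.
Proof.
move=> /unitaryV uA; have -> : unitary A^T = (A^T *m (adj A)^T = 1%:M).
  by congr (_ *m _ = _); apply/matrixP=> i j; rewrite !mxE.
by rewrite -trmx_mul uA trmx1.
Qed.

(** The transpose trick: A on the reference half of the maximally entangled state equals A^T on the
    input half. The left side is the contraction by which [mean_channel] reads a map off its Choi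
    matrix. *)
Lemma choi_tens_conj N L (A B X : 'M[C]_N) k l : is_channel N L ->
  \sum_i \sum_j X i j * (A *t B *m choi L *m adj (A *t B))
    (mxtens_index (i, k)) (mxtens_index (j, l)) =
  N%:R^-1 * (B *m L (A^T *m X *m adj A^T) *m adj B) k l.
Proof.
move=> chL; pose G i j := (B *m L (delta_mx i j) *m adj B) k l.
have JE i j : (A *t B *m choi L *m adj (A *t B))
    (mxtens_index (i, k)) (mxtens_index (j, l)) =
    \sum_q A i q.1 * Num.conj (A j q.2) * (N%:R^-1 * G q.1 q.2).
  rewrite mxE sum_mxtens.
  rewrite -(pair_bigA _ (fun i' j' => A i i' * Num.conj (A j j') * (N%:R^-1 * G i' j'))).
  rewrite exchange_big /=; apply: eq_bigr => j' _.
  under eq_bigr => l' _.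
    rewrite adj_tens tensmxE mxE sum_mxtens mulr_suml.
    under eq_bigr => i' _.
      rewrite mulr_suml.
      under eq_bigr => k' _.
        rewrite tensmxE [choi L _ _]mxE !mxtens_indexK /= !adjE.
        over.
      over.
    over.
  rewrite exchange_big; apply: eq_bigr => i' _ /=.
  rewrite /G mxE !mulr_sumr; apply: eq_bigr => l' _.
  rewrite mxE mulr_suml !mulr_sumr; apply: eq_bigr => k' _.
  by rewrite adjE; ring.
have XE : A^T *m X *m adj A^T = \sum_q
    (\sum_p A p.1 q.1 * X p.1 p.2 * Num.conj (A p.2 q.2)) *: delta_mx q.1 q.2.
  rewrite [LHS]matrix_sum_delta pair_bigA; apply: eq_bigr => -[i' j'] _ /=.
  congr (_ *: _); rewrite mxE.
  rewrite -(pair_bigA _ (fun i j => A i i' * X i j * Num.conj (A j j'))).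
  rewrite exchange_big; apply: eq_bigr => j _ /=.
  rewrite mxE mulr_suml; apply: eq_bigr => i _.
  by rewrite adjE !mxE.
rewrite XE (channel_sum chL) mulmx_sumr mulmx_suml summxE mulr_sumr pair_bigA /=.
under eq_bigr do rewrite JE mulr_sumr.
rewrite exchange_big; apply: eq_bigr => q _ /=.
rewrite -scalemxAr -scalemxAl mxE -/(G q.1 q.2) mulrCA mulr_suml.
by apply: eq_bigr => p _; ring.
Qed.

Lemma mean_channel_twirl d n L : odd d -> is_channel (d ^ n) L ->
  exists (I : finType) (mu : I -> R) (A B : I -> 'M[C]_(d ^ n)),
  [/\ forall i, 0 <= mu i, \sum_i mu i = 1,
      forall i, unitary (A i) /\ unitary (B i) &
      forall X, mean_channel d n L X =
        \sum_i realC (mu i) *: (B i *m L (A i *m X *m adj (A i)) *m adj (B i))].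
Proof.
case: d L => // d' L d_odd chL; set N := (d'.+1 ^ n)%N in L chL *.
have N0 : (0 < N)%N by rewrite expn_gt0.
have NC0 : N%:R != 0 :> C by rewrite pnatr_eq0 -lt0n.
have Jstate := castmx_state (esym (expnD d'.+1 n n)) (choi_state chL N0).
have [mu [mu0 mu1 muE]] := mean_state_twirl d_odd Jstate.
pose T := ({ffun 'I_(n + n) -> 'I_d'.+1} * {ffun 'I_(n + n) -> 'I_d'.+1})%type.
pose A (y : T) : 'M[C]_N :=
  weyl R d'.+1 (toZ y.1 \o @rshift n n) (toZ y.2 \o @rshift n n).
pose B (y : T) : 'M[C]_N :=
  weyl R d'.+1 (toZ y.1 \o @lshift n n) (toZ y.2 \o @lshift n n).
exists _, mu, (fun y => (A y)^T), B; split=> // [y|X].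
  by split; [apply: unitary_tr|]; exact: weyl_unitary.
have {}muE : mean_choi L = \sum_y realC (mu y) *:
    ((A y *t B y) *m choi L *m adj (A y *t B y)).
  rewrite /mean_choi muE castmx_mixture.
  by apply: eq_bigr => y _; rewrite castmx_weyl.
apply/matrixP=> k l; rewrite mxE muE summxE -/N.
transitivity (N%:R * \sum_y realC (mu y) * \sum_i \sum_j X i j *
    (A y *t B y *m choi L *m adj (A y *t B y))
      (mxtens_index (i, k)) (mxtens_index (j, l))).
  congr (_ * _); rewrite pair_bigA /=.
  under [RHS]eq_bigr do rewrite pair_bigA mulr_sumr /=.
  rewrite exchange_big; apply: eq_bigr => -[i j] _ /=.
  rewrite summxE mulr_sumr; apply: eq_bigr => y _.
  by rewrite [X in _ * X]mxE mulrCA.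
rewrite mulr_sumr; apply: eq_bigr => y _.
by rewrite choi_tens_conj // [RHS]mxE mulrCA mulVKf.
Qed.

End MeanChannel.

Theorem mainTheorem19 (R : realType) (d n : nat) (alpha : \bar R)
  (L : 'M[R[i]]_(d ^ n) -> 'M[R[i]]_(d ^ n)) :
  prime d -> (7 <= d)%N -> (1 <= n)%N ->
  ((2^-1 : R)%:E <= alpha)%E ->
  is_channel (d ^ n) L ->
  (H_chan alpha d n L <= H_chan alpha d n (mean_channel d n L))%E.
Proof.
move=> d_prime d7 _ alpha2 chL.
have d_odd : odd d by case: (even_prime d_prime) d7 => [->|].
have [I [mu [A [B [mu0 mu1 AB ME]]]]] := mean_channel_twirl d_odd chL.
rewrite /H_chan; apply: (leeB (lexx _)).
apply: ge_ereal_sup => _ [m [rho [rho_state ->]]].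
pose V i := A i *t (1%:M : 'M[R[i]]_m); pose U i := B i *t (1%:M : 'M[R[i]]_m).
have u1 : unitary (1%:M : 'M[R[i]]_m) by rewrite /unitary adj1 mulmx1.
have Vu i : unitary (V i) by apply: unitary_tens => //; case: (AB i).
have Uu i : unitary (U i) by apply: unitary_tens => //; case: (AB i).
pose rhoV i := V i *m rho *m adj (V i).
have rhoV_state i : is_state (rhoV i).
  case: rho_state => pr tr1; split; first exact: psd_conj.
  by rewrite /rhoV mxtrace_conj.
have -> : tens_id (mean_channel d n L) rho =
    \sum_i realC (mu i) *: (U i *m tens_id L (rhoV i) *m adj (U i)).
  apply: ancilla_block_inj => a b.
  rewrite ancilla_block_tens_id ME ancilla_block_sum; apply: eq_bigr => i _.
  by rewrite ancilla_block_conj ancilla_block_tens_id ancilla_block_conj.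
(* The replacer depends only on the traces of the blocks, which [A i] preserves, and its blocks are
   scalar, hence fixed by [B i]. So the one second argument can be rotated along with each term. *)
have sigmaE i : tens_id (@replacer R _) rho =
    U i *m tens_id (@replacer R _) (rhoV i) *m adj (U i).
  apply: ancilla_block_inj => a b.
  rewrite ancilla_block_conj !ancilla_block_tens_id ancilla_block_conj.
  have [Au Bu] := AB i; rewrite /replacer mxtrace_conj //.
  by rewrite -scalemxAr mulmx1 -scalemxAl Bu.
apply: D_alpha_quasiconvex => // [i||i].
- have [pL trL] := channel_state chL (rhoV_state i).
  by split; [exact: psd_conj|rewrite mxtrace_conj].
- by apply: psd_replacer; case: rho_state.
(* After removing [U i], this is the divergence of L at the admissible input [rhoV i]. *)
- rewrite (sigmaE i) D_alpha_conj //; apply: ereal_sup_ubound.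
  by exists m, (rhoV i).
Qed.
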